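(* Let $X,Y$ be infinite-dimensional Hilbert spaces and $T:X\to Y$ an injective bounded linear operator with non-closed range and $\|T^*T\|\le \exp(-1)$. Let $p>0$, $\rho>0$, $x^\dagger\in X_{f_p}(\rho)$, $y=Tx^\dagger$, and let $y^\delta\in Y$ satisfy $\|y^\delta-y\|\le\delta$. Let $$x(\delta)=g_{\alpha(\delta)}(T^*T)T^*y^\delta,\qquad g_\alpha(\lambda)=\frac{1}{\lambda+(1-\lambda^{\sqrt{\alpha}})^2},$$ with $\alpha(\delta)=\Theta_p^{-1}(\delta)$, where $\Theta_p(\lambda)=\sqrt{\lambda}\,(\ln(1/\lambda))^{-p}$. Then the order optimal estimate $$\|x^\dagger-x(\delta)\|=\mathcal{O}\big(f_p(\delta)\big)\quad\text{as }\delta\to 0$$ holds. Thus the regularization method defined by $g_\alpha$ is order optimal under logarithmic source conditions, i.e. with $R(\delta)=g_{\alpha(\delta)}(T^*T)T^*$ one has $\Delta(\delta,R(\delta),X_{f_p}(\rho))=\mathcal{O}(f_p(\delta))$ as $\delta\to0$.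
   Context: Functions of the self-adjoint operator $T^*T$ are defined by its spectral functional calculus. $f_p(\lambda)=(-\ln\lambda)^{-p}$ and the logarithmic source set is $X_{f_p}(\rho)=\{f_p(T^*T)w:\ w\in X,\ \|w\|\le\rho\}$. For a map $R:Y\to X$ and $M\subset X$, the worst case error is $$\Delta(\delta,R,M)=\sup\{\|Ry^\delta-x^\dagger\|:\ x^\dagger\in M,\ y^\delta\in Y,\ \|y^\delta-Tx^\dagger\|\le\delta\}.$$ A regularization method $R(\delta)$ is order optimal under the logarithmic source condition if $\Delta(\delta,R(\delta),X_{f_p}(\rho))=\mathcal{O}(f_p(\delta))$ as $\delta\to0$. *)

(* Defs.v *)
From mathcomp Require Import all_boot all_order all_algebra.
From mathcomp Require Import sesquilinear.
From mathcomp Require Import all_classical all_reals all_analysis.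
From mathcomp Require complex.

Set Implicit Arguments.
Unset Strict Implicit.
Unset Printing Implicit Defensive.

Import Order.TTheory GRing.Theory Num.Theory.
Import numFieldNormedType.Exports.
Local Open Scope classical_set_scope.
Local Open Scope ring_scope.

(* The scalar field K of a Hilbert space is the field R of real numbers or the
   field of complex numbers.  [rclike R K] records the embedding of R in K, the
   real part and the conjugation.  These laws leave no other choice for K: the
   fixed points of the conjugation are exactly the image of R, so that K has
   degree at most 2 over R.  The two intended instances are given below. *)
Record rclike (R : realType) (K : numFieldType) := RCLike {
  rc_inj : {rmorphism R -> K};
  rc_re : K -> R;
  rc_conj : {rmorphism K -> K};
  rc_reK : forall r, rc_re (rc_inj r) = r;
  rc_addJ : forall k, k + rc_conj k = rc_inj (rc_re k *+ 2);
  rc_mulJ : forall k, k * rc_conj k = `|k| ^+ 2;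
  rc_norm : forall r, `|rc_inj r| = rc_inj `|r| }.

Section RCLikeInstances.
Variable R : realType.

Lemma rclike_real_mulJ (k : R) : k * idfun k = `|k| ^+ 2.
Proof. by rewrite /= real_normK ?num_real // expr2. Qed.

Definition rclike_real : rclike R R :=
  @RCLike R R idfun id idfun (fun=> erefl) (fun=> erefl)
    rclike_real_mulJ (fun=> erefl).

Import complex.

Lemma rclike_complex_addJ (k : complex R) :
  k + Num.conj k = real_complex R (complex.Re k *+ 2).
Proof.
case: k => a b; apply/eqP; rewrite eq_complex /=.
by rewrite subrr mulr2n !eqxx.
Qed.

Lemma rclike_complex_norm (r : R) :
  `|real_complex R r| = real_complex R `|r|.
Proof.
by rewrite normc_def /= expr0n /= addr0 sqrtr_sqr.
Qed.

Definition rclike_complex : rclike R (complex R) :=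
  @RCLike R (complex R) (real_complex R) (@complex.Re R) Num.conj
    (fun=> erefl) rclike_complex_addJ (fun k => esym (normCK k))
    rclike_complex_norm.

End RCLikeInstances.

Section HilbertSpaces.
Variables (R : realType) (K : numFieldType) (c : rclike R K).

(* Norms in a [normedModType K] take their values in K. *)
Definition rnorm (X : normedModType K) (x : X) : R := rc_re c `|x|.

(* The space X, complete for its norm, is a Hilbert space with inner product
   [ip] (linear in its first argument). *)
Definition hilbert (X : completeNormedModType K) (ip : {dot X for rc_conj c}) :=
  forall x : X, `|x| ^+ 2 = ip x x.

Definition infinite_dimensional (X : lmodType K) :=
  forall (n : nat) (v : 'I_n -> X),
    exists x : X, forall a : 'I_n -> K, x <> \sum_i a i *: v i.

Definition bounded_operator (X Y : normedModType K) (T : X -> Y) :=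
  exists C : R, forall x, rnorm (T x) <= C * rnorm x.

Definition opnorm (X Y : normedModType K) (T : X -> Y) : R :=
  sup [set rnorm (T x) | x in [set x | rnorm x <= 1]].

Definition adjoint (X Y : completeNormedModType K)
    (ipX : {dot X for rc_conj c}) (ipY : {dot Y for rc_conj c})
    (T : X -> Y) (y : Y) : X :=
  xget 0 [set z | forall x, ipY (T x) y = ipX x z].

Section SpectralCalculus.
Variables (X : completeNormedModType K) (ip : {dot X for rc_conj c}).

Definition orthogonal_projector (P : X -> X) :=
  [/\ forall a x y, P (a *: x + y) = a *: P x + P y,
      forall x, P (P x) = P x &
      forall x y, ip (P x) y = ip x (P y)].

(* Spectral families (resolutions of the identity), normalised to be strongly
   continuous from the left: E l is the spectral projector of ]-oo, l[. *)
Definition spectral_family (E : R -> X -> X) :=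
  [/\ forall l, orthogonal_projector (E l),
      forall l m x, E l (E m x) = E (Num.min l m) x,
      forall x, E l x @[l --> -oo] --> (0 : X),
      forall x, E l x @[l --> +oo] --> x &
      forall m x, E l x @[l --> m^'-] --> E m x].

(* t_0 <= ... <= t_n is a partition of [a, b] with tags s_i and mesh < d. *)
Definition tagged_partition (a b d : R) (n : nat) (t s : nat -> R) :=
  [/\ t 0%N = a, t n = b &
      forall i, (i < n)%N ->
        t i <= s i <= t i.+1 /\ t i.+1 - t i < d].

Definition rs_sum (E : R -> X -> X) (f : R -> R) (x : X)
    (n : nat) (t s : nat -> R) : X :=
  \sum_(i < n) rc_inj c (f (s i)) *: (E (t i.+1) x - E (t i) x).

(* The Riemann-Stieltjes integral of f dE_l x over [a, b], for continuous f. *)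
Definition is_rs_integral (E : R -> X -> X) (f : R -> R) (a b : R) (x z : X) :=
  forall e : R, 0 < e -> exists2 d : R, 0 < d &
    forall n t s, tagged_partition a b d n t s ->
      rnorm (rs_sum E f x n t s - z) < e.

Definition rs_integral (E : R -> X -> X) (f : R -> R) (a b : R) (x : X) : X :=
  xget 0 [set z | is_rs_integral E f a b x z].

Definition is_spectral_family_of (A : X -> X) (E : R -> X -> X) :=
  spectral_family E /\
  forall x, rs_integral E id ab.1 ab.2 x @[ab --> (-oo, +oo)] --> A x.

(* By the spectral theorem a bounded self-adjoint operator has exactly one
   spectral family. *)
Definition spectral_family_of (A : X -> X) : R -> X -> X :=
  xget (fun _ _ => 0) [set E | is_spectral_family_of A E].

(* f(A)x, the integral of f dE_l x from 0 to ||A||+, for A bounded, self-adjoint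
   and nonnegative and f continuous on a neighbourhood of [0, ||A||] in
   [0, +oo[. *)
Definition spectral_fun (A : X -> X) (f : R -> R) (x : X) : X :=
  lim (rs_integral (spectral_family_of A) f 0 (opnorm A + e) x @[e --> 0^'+]).

End SpectralCalculus.

Section Regularization.
Variables (X Y : completeNormedModType K).
Variables (ipX : {dot X for rc_conj c}) (ipY : {dot Y for rc_conj c}).
Variable T : X -> Y.

(* The operator T^* T. *)
Definition normal_op (x : X) : X := adjoint ipX ipY T (T x).

(* Since ln 0 = 0 and 0 `^ (- p) = 0 for p > 0, this is extended by continuity
   at l = 0. *)
Definition f_log (p l : R) : R := (- ln l) `^ (- p).

Definition log_source_set (p rho : R) : set X :=
  [set spectral_fun ipX normal_op (f_log p) w | w in [set w | rnorm w <= rho]].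

(* The value may be +oo. *)
Definition worst_case_error (delta : R) (Rm : Y -> X) (M : set X) : \bar R :=
  ereal_sup [set e : \bar R | exists (xdag : X) (yd : Y),
    [/\ M xdag, rnorm (yd - T xdag) <= delta &
        e = (rnorm (Rm yd - xdag))%:E]].

Definition order_optimal_log (p rho : R) (Rm : R -> Y -> X) :=
  exists C : R, \forall d \near 0^'+,
    (worst_case_error d (Rm d) (log_source_set p rho) <= (C * f_log p d)%:E)%E.

(* g_alpha; here 0 `^ Num.sqrt alpha = 0, as alpha > 0. *)
Definition g_filter (alpha l : R) : R :=
  (l + (1 - l `^ Num.sqrt alpha) ^+ 2)^-1.

Definition Theta (p l : R) : R := Num.sqrt l * (ln l^-1) `^ (- p).

(* Theta p is an increasing bijection from ]0, 1[ onto ]0, +oo[. *)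
Definition Theta_inv (p d : R) : R :=
  xget 0 [set l | 0 < l < 1 /\ Theta p l = d].

Definition reg_method (p d : R) (y : Y) : X :=
  spectral_fun ipX normal_op (g_filter (Theta_inv p d)) (adjoint ipX ipY T y).

End Regularization.

End HilbertSpaces.

(* Main.v *)
Require Import Defs.
From mathcomp Require Import all_boot all_order all_algebra.
From mathcomp Require Import sesquilinear.
From mathcomp Require Import all_classical all_reals all_analysis.
From mathcomp Require Import ring lra.

Import Order.TTheory GRing.Theory Num.Theory.
Import numFieldNormedType.Exports.
Local Open Scope classical_set_scope.
Local Open Scope ring_scope.

Set Implicit Arguments.
Unset Strict Implicit.
Unset Printing Implicit Defensive.

(** Write A = T^* T, f = f_log p, g = g_filter alpha and x = f(A) w with
    |w| <= rho.  Since T^* y^d = A x + T^* (y^d - T x), the error splits into a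
    propagated noise and an approximation error,
      g(A) T^* y^d - x = g(A) T^* (y^d - T x) - (f - g id f)(A) w
    ([error_decomposition]).  The rest is a pair of scalar estimates on the
    interval [0, exp(-1/2)], whose right end exceeds |A|.

    Noise: |g(A) T^*| <= sup sqrt(l) g(l) ([noise_propagation]).  With
    q = 1 - l^sqrt(alpha), the inequality l + q^2 >= 2 sqrt(l) q and the lower
    bound q >= sqrt(alpha) / 3 give sqrt(l) g(l) <= 2 / sqrt(alpha)
    ([g_filter_sqrt_bound]).

    Approximation: put L = - ln l and a = - ln alpha.  The function to bound is
    L^-p q^2 / (l + q^2).  For L >= a/2, the fraction is at most 1 and L^-p is
    at most 2^p a^-p.  For L < a/2, we have l >= sqrt(alpha) and
    q <= sqrt(alpha) L, so that the fraction is at most sqrt(alpha) a^2, and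
    sqrt(alpha) = exp(-a/2) decays faster than any power of a
    ([residual_bound]).

    The choice Theta p alpha = d says that d / sqrt(alpha) = a^-p, so that both
    terms are O(a^-p).  Finally - ln d = a/2 + p ln a <= (1/2 + p) a turns a^-p
    into a multiple of f_log p d ([rate_f_log]).

    The bounds on functions of A come from one device.  The increments of a
    spectral family E over disjoint intervals are mutually orthogonal, so that
    two Riemann-Stieltjes sums can be compared by splitting E_b x - E_a x along
    both partitions at once and applying Pythagoras ([rs_sum_cmp]).  This yields
    the existence of the integrals, their independence of the endpoints outside
    of the support of E, and the bound by the supremum of the integrand; the
    calculus is multiplicative and symmetric because its sums are.  The support
    of E lies in [0, |A|] because A >= 0 and A <= |A| as quadratic forms
    ([spectral_low], [spectral_high]).

    If A had no spectral family, the functional calculus would be built on the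
    default family 0 and vanish identically; the source set would be {0}, the
    method would be 0, and so would be the error. *)

(** * Real part and real norm *)

Section RealPart.
Variables (R : realType) (K : numFieldType) (c : rclike R K).
Local Notation inj := (rc_inj c).
Local Notation re := (rc_re c).
Local Notation conj := (rc_conj c).

Lemma rc_inj_inj : injective inj.
Proof. exact: (can_inj (@rc_reK _ _ c)). Qed.

(** [rc_addJ] determines twice the real part as the value of the additive map
    k + conj k, and the embedding of R is injective. *)
Lemma rc_reD k l : re (k + l) = re k + re l.
Proof.
have H : inj ((re k + re l) *+ 2) = inj (re (k + l) *+ 2).
  rewrite mulrnDl rmorphD/= -!rc_addJ rmorphD; ring.
by move/rc_inj_inj: H => /eqP; rewrite eqr_pMn2r // => /eqP.
Qed.

Lemma rc_re0 : re 0 = 0.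
Proof. by rewrite -(rmorph0 inj) rc_reK. Qed.

Lemma rc_reN k : re (- k) = - re k.
Proof. by apply/eqP; rewrite -subr_eq0 opprK -rc_reD addNr rc_re0. Qed.

Lemma rc_inj_ge0 r : (0 <= inj r) = (0 <= r).
Proof.
apply/idP/idP => [h|h]; last by rewrite -(ger0_norm h) -rc_norm.
suff -> : r = `|r| by [].
by apply: rc_inj_inj; rewrite -rc_norm ger0_norm.
Qed.

Lemma rc_inj_le r s : (inj r <= inj s) = (r <= s).
Proof. by rewrite -subr_ge0 -rmorphB rc_inj_ge0 subr_ge0. Qed.

Lemma rc_inj_lt r s : (inj r < inj s) = (r < s).
Proof. by rewrite !lt_neqAle rc_inj_le (inj_eq rc_inj_inj). Qed.

(** A nonnegative k satisfies k * conj k = |k|^2 = k^2, hence conj k = k: the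
    values of the K-valued norm are real. *)
Lemma ge0_rc_reK k : 0 <= k -> inj (re k) = k.
Proof.
move=> k0; have [->|kn0] := eqVneq k 0; first by rewrite rc_re0 rmorph0.
have kJ : conj k = k.
  by apply: (mulfI kn0); rewrite rc_mulJ ger0_norm // expr2.
have := rc_addJ c k; rewrite kJ -mulr2n rmorphMn /= => /eqP.
by rewrite eqr_pMn2r // => /eqP.
Qed.

Lemma rc_reJ k : re (conj k) = re k.
Proof.
have h := rc_addJ c k.
have : re (k + conj k) = re k *+ 2 by rewrite h rc_reK.
by rewrite rc_reD mulr2n => /addrI.
Qed.

Lemma rc_conj_inj r : conj (inj r) = inj r.
Proof.
apply: (addrI (inj r)).
by rewrite rc_addJ rc_reK rmorphMn mulr2n.
Qed.

Lemma rc_re_injM r k : re (inj r * k) = r * re k.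
Proof.
have H : inj ((r * re k) *+ 2) = inj (re (inj r * k) *+ 2).
  rewrite -mulrnAr rmorphM /= -!rc_addJ rmorphM rc_conj_inj; ring.
by move/rc_inj_inj: H => /eqP; rewrite eqr_pMn2r // => /eqP.
Qed.

Lemma rc_re_mulJ_eq0 k : re (k * conj k) = 0 -> k = 0.
Proof.
rewrite rc_mulJ => /(congr1 inj); rewrite ge0_rc_reK ?exprn_ge0 // rmorph0.
by move/eqP; rewrite expf_eq0 /= normr_eq0 => /eqP.
Qed.

Section Norm.
Variable X : normedModType K.
Implicit Types x y : X.
Local Notation nm := (@rnorm R K c X).

Lemma rnormE x : `|x| = inj (nm x).
Proof. by rewrite /rnorm ge0_rc_reK. Qed.

Lemma rnorm_ge0 x : 0 <= nm x.
Proof. by rewrite -rc_inj_ge0 -rnormE. Qed.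

Lemma rnorm0 : nm 0 = 0.
Proof. by rewrite /rnorm normr0 rc_re0. Qed.

Lemma rnorm_eq0 x : nm x = 0 -> x = 0.
Proof. by move=> h; apply/eqP; rewrite -normr_eq0 rnormE h rmorph0. Qed.

Lemma rnormN x : nm (- x) = nm x.
Proof. by rewrite /rnorm normrN. Qed.

Lemma rnormB x y : nm (x - y) = nm (y - x).
Proof. by rewrite /rnorm distrC. Qed.

Lemma rnormD x y : nm (x + y) <= nm x + nm y.
Proof. by rewrite -rc_inj_le rmorphD -!rnormE ler_normD. Qed.

Lemma rnormZ r x : nm (inj r *: x) = `|r| * nm x.
Proof.
by apply: rc_inj_inj; rewrite rmorphM -!rnormE normrZ rc_norm.
Qed.

(** Limits in X can be checked against radii in R, although the balls of X have
    their radii in K. *)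
Lemma rnorm_cvgP (I : Type) (F : set_system I) (FF : Filter F) (u : I -> X) l :
  (forall e : R, 0 < e -> \forall i \near F, nm (u i - l) < e) <->
  u @ F --> l.
Proof.
split=> [h|/cvgrPdist_lt h e e0].
  apply/cvgrPdist_lt => e e0; have := h (re e).
  rewrite -rc_inj_lt rmorph0 ge0_rc_reK ?ltW // => /(_ e0).
  apply: filterS => i; rewrite rnormB -rc_inj_lt -rnormE.
  by rewrite ge0_rc_reK ?ltW.
have := h (inj e); rewrite -(rmorph0 inj) rc_inj_lt => /(_ e0).
by apply: filterS => i; rewrite rnormE rc_inj_lt rnormB.
Qed.

Lemma rnorm_cvg (u : nat -> X) l : u @ \oo --> l -> nm \o u @ \oo --> nm l.
Proof.
move=> /rnorm_cvgP h; apply/cvgrPdist_lt => e e0.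
have := h e e0; apply: filterS => i /=; apply: le_lt_trans.
rewrite ler_norml; apply/andP; split.
  rewrite lerNl opprB lerBlDr; apply: le_trans (rnormD _ _).
  by rewrite subrK.
rewrite lerBlDr rnormB; apply: le_trans (rnormD _ _).
by rewrite subrK.
Qed.

Lemma rnorm_lim_le (u : nat -> X) l M :
  u @ \oo --> l -> (forall n, nm (u n) <= M) -> nm l <= M.
Proof.
move=> /rnorm_cvg ul uM; apply: (cvgr_to_le ul).
by apply: nearW => n; exact: uM.
Qed.

End Norm.

Lemma rnorm_cauchy (X : completeNormedModType K) (u : nat -> X) :
  (forall e : R, 0 < e -> exists N, forall m n, (N <= m)%N -> (N <= n)%N ->
     rnorm c (u m - u n) < e) ->
  exists l : X, u @ \oo --> l.
Proof.
move=> h; apply/cvg_ex; apply/cauchy_cvgP/cauchy_exP => e e0.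
have re0 : 0 < re e by rewrite -rc_inj_lt rmorph0 ge0_rc_reK ?ltW.
have [N hN] := h _ re0.
exists (u N); exists N => // n /= Nn; rewrite -ball_normE /=.
by rewrite rnormE -(ge0_rc_reK (ltW e0)) rc_inj_lt; apply: hN.
Qed.

End RealPart.

(** * Real inner product and adjoint *)

Section RealInnerProduct.
Variables (R : realType) (K : numFieldType) (c : rclike R K).
Local Notation inj := (rc_inj c).
Local Notation re := (rc_re c).

(** Up to the imaginary part, X is a real Hilbert space; all the estimates are
    made there. *)
Definition rip (X : completeNormedModType K) (ip : {dot X for rc_conj c})
  (x y : X) : R := re (ip x y).

Section InnerProduct.
Variables (X : completeNormedModType K) (ip : {dot X for rc_conj c}).
Hypothesis hX : hilbert ip.
Implicit Types x y z : X.
Local Notation nm := (@rnorm R K c X).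
Local Notation "<< x , y >>" := (rip ip x y) (at level 0, x, y at level 99).

Lemma ripC x y : << x, y >> = << y, x >>.
Proof. by rewrite /rip hermC expr0 mul1r rc_reJ. Qed.

Lemma ripDl x y z : << x + y, z >> = << x, z >> + << y, z >>.
Proof. by rewrite /rip linearDl rc_reD. Qed.

Lemma ripDr x y z : << x, y + z >> = << x, y >> + << x, z >>.
Proof. by rewrite ![<< x, _ >>]ripC ripDl. Qed.

Lemma ripZl r x y : << inj r *: x, y >> = r * << x, y >>.
Proof. by rewrite /rip linearZl_LR rc_re_injM. Qed.

Lemma ripZr r x y : << x, inj r *: y >> = r * << x, y >>.
Proof. by rewrite ripC ripZl ripC. Qed.

Lemma ripNl x y : << - x, y >> = - << x, y >>.
Proof. by rewrite /rip linearNl rc_reN. Qed.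

Lemma ripNr x y : << x, - y >> = - << x, y >>.
Proof. by rewrite ripC ripNl ripC. Qed.

Lemma ripBl x y z : << x - y, z >> = << x, z >> - << y, z >>.
Proof. by rewrite ripDl ripNl. Qed.

Lemma ripBr x y z : << x, y - z >> = << x, y >> - << x, z >>.
Proof. by rewrite ripDr ripNr. Qed.

Lemma rip0l x : << 0, x >> = 0.
Proof. by rewrite -[X in << X, _ >>](subrr x) ripBl subrr. Qed.

Lemma rip_suml (I : finType) (v : I -> X) y :
  << \sum_i v i, y >> = \sum_i << v i, y >>.
Proof.
by apply: (big_morph (fun u => << u, y >>)) => [a b|]; rewrite ?ripDl ?rip0l.
Qed.

Lemma ripxx x : << x, x >> = nm x ^+ 2.
Proof. by rewrite /rip -hX (rnormE c) -rmorphXn rc_reK. Qed.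

Lemma ripxx_eq0 x : << x, x >> = 0 -> x = 0.
Proof. by rewrite ripxx => /eqP; rewrite expf_eq0 /= => /eqP /rnorm_eq0. Qed.

Lemma rnormD2 x y : nm (x + y) ^+ 2 = nm x ^+ 2 + 2 * << x, y >> + nm y ^+ 2.
Proof. by rewrite -!ripxx ripDl !ripDr (ripC y x); ring. Qed.

(** Cauchy-Schwarz, from the square of the norm of |y| x - |x| y. *)
Lemma rip_le x y : << x, y >> <= nm x * nm y.
Proof.
have [->|x0] := eqVneq x 0; first by rewrite rip0l rnorm0 mul0r.
have [->|y0] := eqVneq y 0; first by rewrite ripC rip0l rnorm0 mulr0.
have gt0 z : z != 0 -> 0 < nm z.
  move=> z0; rewrite lt_neqAle rnorm_ge0 andbT eq_sym.
  by apply: contra_neq z0 => /rnorm_eq0.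
have := sqr_ge0 (nm (inj (nm y) *: x + inj (- nm x) *: y)).
rewrite rnormD2 !rnormZ ripZl ripZr normrN !ger0_norm ?rnorm_ge0 //.
have xy0 := mulr_gt0 (gt0 _ x0) (gt0 _ y0).
move=> h; rewrite -(ler_pM2l xy0); nra.
Qed.

Lemma rip_abs_le x y : `| << x, y >> | <= nm x * nm y.
Proof.
by rewrite ler_norml rip_le andbT lerNl -ripNl (le_trans (rip_le _ _)) ?rnormN.
Qed.

Lemma rip_cvg (I : Type) (F : set_system I) (FF : Filter F) (u : I -> X) l y :
  u @ F --> l -> << u i, y >> @[i --> F] --> << l, y >>.
Proof.
move=> /(rnorm_cvgP c) h; apply/cvgrPdist_lt => e e0.
have d0 : 0 < nm y + 1 by rewrite ltr_wpDl ?rnorm_ge0.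
have := h _ (divr_gt0 e0 d0); apply: filterS => n.
rewrite ltr_pdivlMr // -ripBl; apply: le_lt_trans.
rewrite (le_trans (rip_abs_le _ _)) // rnormB ler_wpM2l ?rnorm_ge0 //.
by rewrite lerDl.
Qed.

(** By Pythagoras, both sides are weighted sums of the |v i|^2. The bound on
    the coefficients is only asked where [v i] is nonzero: in a double
    partition, these are the pairs of overlapping intervals. *)
Lemma orthogonal_sum_le (I : finType) (v : I -> X) (a : I -> R) M : 0 <= M ->
  (forall i j, i != j -> << v i, v j >> = 0) ->
  (forall i, v i != 0 -> `|a i| <= M) ->
  nm (\sum_i inj (a i) *: v i) <= M * nm (\sum_i v i).
Proof.
move=> M0 ort aM.
have sq (b : I -> R) :
    nm (\sum_i inj (b i) *: v i) ^+ 2 = \sum_i b i ^+ 2 * nm (v i) ^+ 2.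
  rewrite -ripxx rip_suml; apply: eq_bigr => i _.
  rewrite ripC rip_suml (bigD1 i) //= big1 ?addr0 => [|j ji].
    by rewrite ripZl ripZr ripxx; ring.
  by rewrite ripZl ripZr ort // !mulr0.
have -> : \sum_i v i = \sum_i inj 1 *: v i.
  by apply: eq_bigr => i _; rewrite rmorph1 scale1r.
rewrite -(ler_pXn2r (n := 2)) // ?nnegrE ?mulr_ge0 ?rnorm_ge0 //.
rewrite exprMn !sq mulr_sumr; apply: ler_sum => i _.
have [->|/aM vi] := eqVneq (v i) 0; first by rewrite rnorm0 expr0n /= !mulr0.
rewrite expr1n mul1r ler_wpM2r ?sqr_ge0 //.
by rewrite -real_normK ?num_real // ler_pXn2r ?nnegrE.
Qed.

End InnerProduct.

Section Adjoint.
Variables (X Y : completeNormedModType K).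
Variables (ipX : {dot X for rc_conj c}) (ipY : {dot Y for rc_conj c}).
Hypotheses (hX : hilbert ipX) (hY : hilbert ipY).
Variable T : {linear X -> Y}.
Hypothesis T_bnd : bounded_operator c T.
Local Notation nm := (rnorm c).

Lemma bounded_operator_pos :
  exists2 C : R, 0 <= C & forall x, nm (T x) <= C * nm x.
Proof.
have [C hC] := T_bnd; exists `|C| => // x.
by rewrite (le_trans (hC x)) // ler_wpM2r ?rnorm_ge0 // ler_norm.
Qed.

(** The Riesz representation of the functional x |-> <T x, y>: a minimising
    sequence of the energy |x|^2 - 2 Re <T x, y> is Cauchy by the parallelogram
    identity, and the first variation of the energy vanishes at its limit. *)
Lemma riesz y : exists z, forall x, rip ipY (T x) y = rip ipX x z.
Proof.
have [C C0 hC] := bounded_operator_pos.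
pose J x := nm x ^+ 2 - 2 * rip ipY (T x) y.
pose S := range J.
have Jlow x : - (C * nm y) ^+ 2 <= J x.
  have h := rip_le hY (T x) y; rewrite /J.
  have h2 : nm (T x) * nm y <= C * nm x * nm y by rewrite ler_wpM2r ?rnorm_ge0.
  have := sqr_ge0 (nm x - C * nm y); nra.
have Slb : has_inf S.
  split; first by exists (J 0), 0.
  by exists (- (C * nm y) ^+ 2) => _ [x _ <-].
set m := inf S.
have Jm x : m <= J x by apply: ge_inf; [exact: Slb.2 | exists x].
have /boolp.choice[u uP] : forall n : nat, exists x, J x < m + n.+1%:R^-1.
  move=> n; have n0 : 0 < n.+1%:R^-1 :> R by rewrite invr_gt0.
  by have [_ [x _ <-] xm] := inf_adherent n0 Slb; exists x.
have TZ r x : T (inj r *: x) = inj r *: T x by rewrite linearZ.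
have TD x x' : T (x + x') = T x + T x' by rewrite linearD.
(* The parallelogram identity, with J at the midpoint bounded below by m. *)
have para x x' : nm (x - x') ^+ 2 <= 2 * (J x - m) + 2 * (J x' - m).
  have := Jm (inj 2^-1 *: (x + x')).
  rewrite /J TZ TD ripZl ripDl rnormZ ger0_norm ?invr_ge0 //.
  rewrite exprMn !(rnormD2 hX) rnormN ripNr; lra.
have invlt (e : R) : 0 < e -> exists N : nat, N.+1%:R^-1 < e.
  move=> e0; exists (Num.truncn e^-1).
  rewrite -(invrK e) ltf_pV2 ?posrE ?invr_gt0 // ?ltr0n //.
  by rewrite invrK truncnS_gt.
have mono (N n : nat) : (N <= n)%N -> n.+1%:R^-1 <= N.+1%:R^-1 :> R.
  by move=> Nn; rewrite lef_pV2 ?posrE ?ltr0n // ler_nat.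
have [z uz] : exists z : X, u @ \oo --> z.
  apply: (rnorm_cauchy (c := c)) => e e0.
  have [N hN] := invlt (e ^+ 2 / 4) ltac:(by rewrite divr_gt0 // exprn_gt0).
  exists N => i j Ni Nj.
  rewrite -(ltr_pXn2r (n := 2)) // ?nnegrE ?rnorm_ge0 ?ltW //.
  apply: le_lt_trans (para _ _) _.
  have := uP i; have := uP j; have := mono _ _ Ni; have := mono _ _ Nj.
  move: hN; move: (N.+1%:R^-1) (i.+1%:R^-1) (j.+1%:R^-1) => p q r; lra.
exists z => h; apply/esym/eqP; rewrite -subr_eq0.
pose D n := rip ipX (u n) h - rip ipY (T h) y.
have Dcvg : D @ \oo --> rip ipX h z - rip ipY (T h) y.
  by rewrite ripC; apply: cvgB; [exact: rip_cvg | exact: cvg_cst].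
pose H := nm h ^+ 2 + 1.
have H0 : 0 < H by rewrite ltr_wpDl ?sqr_ge0.
have Dsmall n : D n ^+ 2 <= n.+1%:R^-1 * H.
  (* The step -D/H almost minimises J along h; H is |h|^2 made positive. *)
  have := Jm (u n + inj (- (D n / H)) *: h).
  rewrite /J TD TZ ripDl ripZl (rnormD2 hX) rnormZ normrN.
  rewrite exprMn real_normK ?num_real // ripZr.
  have := uP n; rewrite /J.
  have -> : nm h ^+ 2 = H - 1 by rewrite /H addrK.
  set t := D n / H; have tH : D n = t * H by rewrite /t divfK // gt_eqF.
  rewrite tH; have : rip ipX (u n) h = t * H + rip ipY (T h) y.
    by rewrite -tH /D subrK.
  move=> -> h1 h2.
  rewrite exprMn expr2 mulrA ler_wpM2r //; first exact: ltW.
  have := sqr_ge0 t.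
  move: h1 h2; move: (n.+1%:R^-1) => q; clearbody t H; lra.
apply/negPn/negP => L0; set L := _ - _ in L0 Dcvg.
have L2 : 0 < L ^+ 2 by rewrite exprn_even_gt0.
have [N hN] := invlt (L ^+ 2 / (4 * H)) ltac:(by rewrite divr_gt0 // mulr_gt0).
have /cvgrPdist_lt/(_ (`|L| / 2)) := Dcvg.
case=> [|N' _ hN']; first by rewrite divr_gt0 // normr_gt0.
have := hN' (maxn N N') (leq_maxr _ _); set k := maxn N N' => Lk.
have Dk : `|L| / 2 < `|D k|.
  have := ler_normD (L - D k) (D k); rewrite subrK; lra.
have : `|L| ^+ 2 / 4 < `|D k| ^+ 2 by have := normr_ge0 L; nra.
rewrite !real_normK ?num_real // ltNge => /negP; apply.
apply: le_trans (Dsmall k) _; rewrite -ler_pdivlMr //.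
apply: le_trans (mono _ _ (leq_maxl _ _)) _.
by rewrite (le_trans (ltW hN)) // invfM mulrA.
Qed.

(** The real part determines the whole form: test with the multiple of the
    vector by the conjugate of the difference. *)
Lemma adjointP x y : ipY (T x) y = ipX x (adjoint ipX ipY T y).
Proof.
rewrite /adjoint; case: xgetP => [z _ //|noadj]; exfalso.
have [z hz] := riesz y; apply: (noadj z) => h; apply/eqP; rewrite -subr_eq0.
apply/eqP; apply: (@rc_re_mulJ_eq0 _ _ c); set w := _ - _.
have := hz (rc_conj c w *: h); rewrite linearZ /= /rip !linearZl_LR /= => e.
by rewrite mulrC mulrBr rc_reD rc_reN e subrr.
Qed.

Lemma rip_adjoint x y : rip ipY (T x) y = rip ipX x (adjoint ipX ipY T y).
Proof. by rewrite /rip adjointP. Qed.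

Lemma rip_inj x y : (forall z, rip ipX z x = rip ipX z y) -> x = y.
Proof.
move=> h; apply/eqP; rewrite -subr_eq0; apply/eqP; apply: (ripxx_eq0 hX).
by rewrite ripBr h subrr.
Qed.

Lemma adjointB y z :
  adjoint ipX ipY T (y - z) = adjoint ipX ipY T y - adjoint ipX ipY T z.
Proof. by apply: rip_inj => x; rewrite ripBr -!rip_adjoint ripBr. Qed.

Lemma adjoint_bounded :
  exists2 C, 0 <= C & forall y, nm (adjoint ipX ipY T y) <= C * nm y.
Proof.
have [C C0 hC] := bounded_operator_pos; exists C => // y.
set z := adjoint _ _ _ y.
have [z0|zn0] := eqVneq (nm z) 0; first by rewrite z0 mulr_ge0 ?rnorm_ge0.
have zgt0 : 0 < nm z by rewrite lt_neqAle eq_sym zn0 rnorm_ge0.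
rewrite -(ler_pM2l zgt0) -expr2 -(ripxx hX) -rip_adjoint.
rewrite (le_trans (rip_le hY _ _)) // mulrA ler_wpM2r ?rnorm_ge0 //.
by rewrite mulrC.
Qed.

Lemma normal_op_ge0 x : rip ipX (normal_op ipX ipY T x) x = nm (T x) ^+ 2.
Proof. by rewrite ripC -rip_adjoint ripxx. Qed.

Lemma normal_op0 : normal_op ipX ipY T 0 = 0.
Proof.
apply: (ripxx_eq0 hX); rewrite {2}/normal_op -rip_adjoint.
by rewrite (linear0 T) ripC rip0l.
Qed.

(** The supremum defining [opnorm] is that of a bounded set, since both T and
    its adjoint are bounded. *)
Lemma opnorm_normal_op :
  0 <= opnorm c (normal_op ipX ipY T) /\
  forall x, nm (normal_op ipX ipY T x) <= opnorm c (normal_op ipX ipY T) * nm x.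
Proof.
have [C C0 hC] := bounded_operator_pos.
have [C' C'0 hC'] := adjoint_bounded.
set A := normal_op ipX ipY T.
set S := [set nm (A x) | x in [set x | nm x <= 1]].
have Sup : has_ubound S.
  exists (C' * C) => _ [x /= x1 <-]; rewrite (le_trans (hC' _)) //.
  rewrite ler_wpM2l // (le_trans (hC _)) // -[leRHS]mulr1.
  by rewrite ler_wpM2l.
have A0 : 0 <= opnorm c A.
  apply: ub_le_sup => //; exists 0 => /=; rewrite ?rnorm0 //.
  by rewrite /A normal_op0 rnorm0.
split=> // x; have [x0|xn0] := eqVneq (nm x) 0.
  by rewrite (rnorm_eq0 x0) /A normal_op0 rnorm0 mulr_ge0 // rnorm_ge0.
have xgt0 : 0 < nm x by rewrite lt_neqAle eq_sym xn0 rnorm_ge0.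
have AZ r z : A (inj r *: z) = inj r *: A z.
  apply: rip_inj => v; rewrite ripZr /A /normal_op -!rip_adjoint linearZ /=.
  by rewrite ripZr.
have : nm (A (inj (nm x)^-1 *: x)) <= opnorm c A.
  apply: (ub_le_sup Sup); exists (inj (nm x)^-1 *: x); last by [].
  rewrite /=.
  by rewrite rnormZ ger0_norm ?invr_ge0 ?rnorm_ge0 // mulVf.
by rewrite AZ rnormZ ger0_norm ?invr_ge0 ?rnorm_ge0 // mulrC ler_pdivrMr.
Qed.

End Adjoint.
End RealInnerProduct.

(** * Riemann-Stieltjes sums of a spectral family *)

Section UniformContinuity.
Variable R : realType.

Definition unif_cont_on (a b : R) (f : R -> R) :=
  forall e, 0 < e -> exists2 d, 0 < d & forall s s',
    a <= s <= b -> a <= s' <= b -> `|s - s'| < d -> `|f s - f s'| < e.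

(** The Heine-Cantor theorem, by compactness of the segment. *)
Lemma segment_unif_cont (a b : R) f :
  {within `[a, b], continuous f} -> unif_cont_on a b f.
Proof.
move=> /subspace_continuousP cf e e0.
have e20 : 0 < e / 2 by rewrite divr_gt0.
pose P (d x : R) := forall y, a <= x <= b -> a <= y <= b ->
  `|x - y| < d -> `|f x - f y| < e.
have /compact_near_coveringP/(_ R 0^'+ P _) := @segment_compact R a b.
case=> [x abx|d [d0 hd]]; last first.
  exists (d / 2); first by rewrite divr_gt0.
  move=> s s' hs hs'; apply: hd => //=.
  - by rewrite sub0r normrN gtr0_norm ?divr_gt0 // ltr_pdivrMr // ltr_pMr ?ltr1n.
  - by rewrite divr_gt0.
have [r r0 hr] : exists2 r : R, 0 < r & forall y : R,
    a <= y <= b -> `|x - y| < r -> `|f x - f y| < e / 2.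
  have := cf x abx; move=> /cvgrPdist_lt/(_ _ e20).
  rewrite near_withinE => -[r /= r0 hr]; exists r => // y aby xy.
  by apply: hr => //=; rewrite ?in_itv.
have r20 : 0 < r / 2 by rewrite divr_gt0.
exists (ball x (r / 2), [set d | 0 < d < r / 2]).
  split; first exact: nbhsx_ballx.
  exists (r / 2) => // d /=; rewrite sub0r normrN => dr d0.
  by rewrite d0 /= (le_lt_trans (ler_norm _) dr).
suff loc (x' d : R) : `|(x : R) - x'| < r / 2 -> d < r / 2 -> P d x'.
  by move=> [x' d] [/= + /andP[d0 dr]]; rewrite -ball_normE /= => /loc; exact.
move: (x : R) hr => {abx}x hr xx' dr y abx' aby x'y.
have h1 : `|f x - f x'| < e / 2 by apply: hr => //; lra.
have h2 : `|f x - f y| < e / 2.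
  by apply: hr => //; have := ler_distD x' x y; lra.
have := ler_distD (f x) (f x') (f y); rewrite (distrC (f x') (f x)); lra.
Qed.

Lemma unif_cont_id (a b : R) : unif_cont_on a b id.
Proof. by move=> e e0; exists e. Qed.

Lemma unif_cont_sub (a b a' b' : R) f : a' <= a -> b <= b' ->
  unif_cont_on a' b' f -> unif_cont_on a b f.
Proof.
move=> aa bb h e /h[d d0 hd]; exists d => // s s' /andP[as_ sb] /andP[as' sb'].
by apply: hd; apply/andP; split; lra.
Qed.

End UniformContinuity.

Section Partitions.
Variable R : realType.

Lemma tagged_partition_mono (a b d : R) n t s i j :
  tagged_partition a b d n t s -> (i <= j <= n)%N -> t i <= t j.
Proof.
move=> [_ _ h] /andP[]; elim: j => [|j IH].
  by rewrite leqn0 => /eqP ->.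
rewrite leq_eqVlt => /orP[/eqP -> //|ij] jn.
have [/andP[h1 h2] _] := h j jn.
by rewrite (le_trans (IH ij (ltnW jn))) // (le_trans h1 h2).
Qed.

Lemma tagged_partition_in (a b d : R) n t s i :
  tagged_partition a b d n t s -> (i < n)%N ->
  [/\ a <= t i, t i.+1 <= b, t i <= s i, s i <= t i.+1 & t i.+1 - t i < d].
Proof.
move=> p lin; have [t0 tn h] := p.
have [/andP[h1 h2] h3] := h i lin; split => //.
- by rewrite -t0; apply: (tagged_partition_mono p); rewrite leq0n ltnW.
- by rewrite -tn; apply: (tagged_partition_mono p); rewrite lin leqnn.
Qed.

Lemma tagged_partition_le (a b d : R) n t s :
  tagged_partition a b d n t s -> a <= b.
Proof.
move=> p; have [<- <- _] := p.
by apply: (tagged_partition_mono p); rewrite leqnn.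
Qed.

Lemma tagged_partition_mesh (a b d d' : R) n t s : d <= d' ->
  tagged_partition a b d n t s -> tagged_partition a b d' n t s.
Proof.
move=> dd [h1 h2 h3]; split => // i /h3[? ?]; split => //.
exact: lt_le_trans dd.
Qed.

Definition even_point (a b : R) n i : R := a + (b - a) * (i%:R / n%:R).

Lemma even_partitionP (a b d : R) n : a <= b -> 0 < d ->
  (b - a) / d < n.+1%:R ->
  tagged_partition a b d n.+1 (even_point a b n.+1) (even_point a b n.+1).
Proof.
move=> ab d0 hn; have n0 : 0 < n.+1%:R :> R by rewrite ltr0n.
split; rewrite /even_point; first by rewrite mul0r mulr0 addr0.
  by rewrite divff ?gt_eqF // mulr1 addrC subrK.
have step i : (i.+1%:R : R) / n.+1%:R = i%:R / n.+1%:R + n.+1%:R^-1.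
  by rewrite -addn1 natrD mulrDl mul1r.
move=> i _; rewrite step lexx /= mulrDr addrA lerDl; split.
  by rewrite mulr_ge0 ?subr_ge0 ?invr_ge0 // ltW.
rewrite [X in X < _]addrAC subrr add0r ltr_pdivrMr //.
by rewrite mulrC -ltr_pdivrMr.
Qed.

Lemma even_partition_any (a b : R) n : a <= b ->
  tagged_partition a b (b - a + 1) n.+1
    (even_point a b n.+1) (even_point a b n.+1).
Proof.
move=> ab; have d0 : 0 < b - a + 1 by rewrite ltr_wpDl ?subr_ge0.
apply: even_partitionP => //; rewrite ltr_pdivrMr //.
by rewrite (lt_le_trans (ltr_pwDr ltr01 (lexx _))) // ler_peMl ?(ltW d0) // ler1n.
Qed.

Lemma even_partition (a b d : R) : a <= b -> 0 < d ->
  exists N, forall n, (N <= n)%N ->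
    tagged_partition a b d n.+1 (even_point a b n.+1) (even_point a b n.+1).
Proof.
move=> ab d0; exists (Num.truncn ((b - a) / d)) => n Nn.
apply: even_partitionP => //.
by apply: (lt_le_trans (truncnS_gt _)); rewrite ler_nat ltnS.
Qed.

End Partitions.

Section SpectralFamily.
Variables (R : realType) (K : numFieldType) (c : rclike R K).
Variables (X : completeNormedModType K) (ip : {dot X for rc_conj c}).
Hypothesis hX : hilbert ip.
Variable E : R -> X -> X.
Hypothesis hE : spectral_family ip E.
Local Notation inj := (rc_inj c).
Local Notation nm := (@rnorm R K c X).
Local Notation rp := (rip ip).
Implicit Types (x y z : X) (a b l m : R).

Lemma spectralD l x y : E l (x + y) = E l x + E l y.
Proof.
have [/(_ l)[h _ _] _ _ _ _] := hE.
by have := h 1 x y; rewrite !scale1r.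
Qed.

Lemma spectral0 l : E l 0 = 0.
Proof. by apply: (addrI (E l 0)); rewrite -spectralD !addr0. Qed.

Lemma spectralZ l k x : E l (k *: x) = k *: E l x.
Proof.
have [/(_ l)[h _ _] _ _ _ _] := hE.
by have := h k x 0; rewrite spectral0 !addr0.
Qed.

Lemma spectralN l x : E l (- x) = - E l x.
Proof. by rewrite -scaleN1r spectralZ scaleN1r. Qed.

Lemma spectral_min l m x : E l (E m x) = E (Num.min l m) x.
Proof. by have [_ h _ _ _] := hE. Qed.

Lemma spectral_sym l x y : rp (E l x) y = rp x (E l y).
Proof. by have [/(_ l)[_ _ h] _ _ _ _] := hE; rewrite /rip h. Qed.

(** The spectral projector of [a, b[. *)
Definition spectral_incr a b x := E b x - E a x.
Local Notation inc := spectral_incr.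

Lemma incD a b x y : inc a b (x + y) = inc a b x + inc a b y.
Proof. by rewrite /inc !spectralD opprD addrACA. Qed.

Lemma incZ a b k x : inc a b (k *: x) = k *: inc a b x.
Proof. by rewrite /inc !spectralZ scalerBr. Qed.

Lemma inc0 a b : inc a b 0 = 0.
Proof. by rewrite /inc !spectral0 subrr. Qed.

Lemma inc_sum a b (I : finType) (v : I -> X) :
  inc a b (\sum_i v i) = \sum_i inc a b (v i).
Proof. by apply: (big_morph (inc a b)); [exact: incD | exact: inc0]. Qed.

Lemma inc_sym a b x y : rp (inc a b x) y = rp x (inc a b y).
Proof. by rewrite /inc ripBl ripBr !spectral_sym. Qed.

Lemma inc_inc a b a' b' x : inc a b (inc a' b' x) =
  E (Num.min b b') x - E (Num.min b a') x
  - (E (Num.min a b') x - E (Num.min a a') x).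
Proof. by rewrite /inc !spectralD !spectralN !spectral_min. Qed.

(** These rules on products of projectors of intervals replace the measure
    algebra of a projection-valued measure: products are indexed by
    intersections. *)
Lemma inc_comm a b a' b' x : inc a b (inc a' b' x) = inc a' b' (inc a b x).
Proof.
rewrite !inc_inc (minC b) (minC a) (minC b a') (minC a).
rewrite !opprB -!addrA; congr (_ + _).
by rewrite addrCA [RHS]addrCA; congr (_ + _); exact: addrC.
Qed.

Lemma inc_disjoint a b a' b' x : a <= b -> a' <= b' -> b <= a' ->
  inc a b (inc a' b' x) = 0.
Proof.
move=> ab ab' ba; rewrite inc_inc !min_l ?subrr //; lra.
Qed.

Lemma inc_sub a b a' b' x : a' <= a -> a <= b -> b <= b' ->
  inc a b (inc a' b' x) = inc a b x.
Proof.
move=> aa ab bb; rewrite inc_inc (min_l bb) (min_l (le_trans ab bb)).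
rewrite !min_r //; last exact: le_trans ab.
by rewrite opprB addrA subrK.
Qed.

Lemma inc_le a b x : a <= b -> nm (inc a b x) <= nm x.
Proof.
move=> ab; have [->|n0] := eqVneq (nm (inc a b x)) 0; first exact: rnorm_ge0.
have gt0 : 0 < nm (inc a b x) by rewrite lt_neqAle eq_sym n0 rnorm_ge0.
rewrite -(ler_pM2l gt0) -expr2 -(ripxx hX) inc_sym inc_sub //.
by rewrite ripC; exact: rip_le.
Qed.

Lemma inc_telescope (t : nat -> R) n x :
  \sum_(i < n) inc (t i) (t i.+1) x = inc (t 0%N) (t n) x.
Proof.
rewrite -(big_mkord xpredT (fun i => inc (t i) (t i.+1) x)).
by rewrite (telescope_sumr (fun i => E (t i) x)).
Qed.

Lemma partition_le (a b d : R) n t s (i : 'I_n) :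
  tagged_partition a b d n t s -> t i <= t i.+1.
Proof. by move=> p; apply: (tagged_partition_mono p); rewrite leqnSn /=. Qed.

Lemma inc_partition_disjoint (a b d : R) n t s (i j : 'I_n) x :
  tagged_partition a b d n t s -> i != j ->
  inc (t i) (t i.+1) (inc (t j) (t j.+1) x) = 0.
Proof.
move=> p; have le k := @partition_le a b d n t s k p.
rewrite -val_eqE neq_ltn => /orP[ij|ji]; last rewrite inc_comm.
  by apply: inc_disjoint => //; apply: (tagged_partition_mono p); rewrite ij ltnW.
by apply: inc_disjoint => //; apply: (tagged_partition_mono p); rewrite ji ltnW.
Qed.

Lemma rs_sumE f x n t s :
  rs_sum c E f x n t s = \sum_(i < n) inj (f (s i)) *: inc (t i) (t i.+1) x.
Proof. by []. Qed.

(** Both sums are sums over the pairs (i, j) of a scalar times the projection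
    of x to the intersection of the i-th and j-th intervals of the two
    partitions. This plays the role of a common refinement. Intervals that do
    not overlap contribute 0, and the tags of those that do are closer than
    d + d'. Two distinct functions are allowed so that one of them can be 0. *)
Lemma rs_sum_cmp a b d n t s a' b' d' n' t' s' f f' (M : R) x : 0 <= M ->
  tagged_partition a b d n t s -> tagged_partition a' b' d' n' t' s' ->
  E a x = E a' x -> E b x = E b' x ->
  (forall i j, (i < n)%N -> (j < n')%N -> `|s i - s' j| < d + d' ->
     `|f (s i) - f' (s' j)| <= M) ->
  nm (rs_sum c E f x n t s - rs_sum c E f' x n' t' s') <= M * nm x.
Proof.
move=> M0 p p' Ea Eb ff.
have [t0 tn _] := p; have [t0' tn' _] := p'.
have incab : inc a b x = inc a' b' x by rewrite /inc Ea Eb.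
have pin i := tagged_partition_in p (ltn_ord i).
have pin' j := tagged_partition_in p' (ltn_ord j).
pose w (k : 'I_n * 'I_n') := inc (t k.1) (t k.1.+1) (inc (t' k.2) (t' k.2.+1) x).
(* As E_b x - E_a x is the same for both partitions, each increment of one is
   the sum of its intersections with the increments of the other. *)
have incl (i : 'I_n) : inc (t i) (t i.+1) x = \sum_j w (i, j).
  have [h1 h2 h3 h4 _] := pin i.
  rewrite -(@inc_sub _ _ a b) //; last exact: le_trans h3 h4.
  by rewrite incab -t0' -tn' -inc_telescope inc_sum.
have incr (j : 'I_n') : inc (t' j) (t' j.+1) x = \sum_i w (i, j).
  have [h1 h2 h3 h4 _] := pin' j.
  rewrite -(@inc_sub _ _ a' b') //; last exact: le_trans h3 h4.
  rewrite -incab -t0 -tn -inc_telescope inc_sum; apply: eq_bigr => i _.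
  exact: inc_comm.
have -> : rs_sum c E f x n t s - rs_sum c E f' x n' t' s' =
    \sum_(k : 'I_n * 'I_n') inj (f (s k.1) - f' (s' k.2)) *: w k.
  transitivity (\sum_(i < n) \sum_(j < n') inj (f (s i) - f' (s' j)) *: w (i, j));
    last by rewrite pair_big; apply: eq_bigr => -[].
  have -> : rs_sum c E f x n t s =
      \sum_(i < n) \sum_(j < n') inj (f (s i)) *: w (i, j).
    by apply: eq_bigr => i _; rewrite -/(inc _ _ _) incl scaler_sumr.
  have -> : rs_sum c E f' x n' t' s' =
      \sum_(i < n) \sum_(j < n') inj (f' (s' j)) *: w (i, j).
    rewrite exchange_big; apply: eq_bigr => j _.
    by rewrite -/(inc _ _ _) incr scaler_sumr.
  rewrite -sumrB; apply: eq_bigr => i _; rewrite -sumrB; apply: eq_bigr => j _.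
  by rewrite rmorphB scalerBl.
have sumw : nm (\sum_k w k) <= nm x.
  have -> : \sum_k w k = inc a b x.
    transitivity (\sum_(i < n) \sum_(j < n') w (i, j)).
      by rewrite pair_big; apply: eq_bigr => -[].
    by rewrite -t0 -tn -inc_telescope; apply: eq_bigr => i _; rewrite incl.
  by apply: inc_le; exact: tagged_partition_le p.
apply: (le_trans _ (ler_wpM2l M0 sumw)).
apply: (orthogonal_sum_le hX) => //.
  move=> [i j] [k l] /= ne; rewrite /w /=.
  have [ik|nik] := eqVneq i k.
    have jl : j != l by apply: contra_neq ne => ->; rewrite ik.
    rewrite (inc_comm (t i)) (inc_comm (t k)) inc_sym.
    by rewrite (inc_partition_disjoint _ p') // ripC rip0l.
  by rewrite inc_sym (inc_partition_disjoint _ p) // ripC rip0l.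
move=> [i j] /= wn0; apply: ff => //.
have [h1 h2 h3 h4 h5] := pin i; have [k1 k2 k3 k4 k5] := pin' j.
have o1 : t' j < t i.+1.
  rewrite ltNge; apply: contra_neqN wn0 => h.
  by apply: inc_disjoint => //; [exact: le_trans h4 | exact: le_trans k4].
have o2 : t i < t' j.+1.
  rewrite ltNge; apply: contra_neqN wn0 => h; rewrite /w inc_comm.
  by apply: inc_disjoint => //; [exact: le_trans k4 | exact: le_trans h4].
by rewrite ltr_norml; apply/andP; split; lra.
Qed.

Lemma rs_sum_bound a b d n t s f (M : R) x : 0 <= M ->
  tagged_partition a b d n t s -> (forall r, a <= r <= b -> `|f r| <= M) ->
  nm (rs_sum c E f x n t s) <= M * nm x.
Proof.
move=> M0 p fM; have -> : rs_sum c E f x n t s =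
    rs_sum c E f x n t s - rs_sum c E (fun=> 0) x n t s.
  by rewrite [X in _ - X]big1 ?subr0 // => i _; rewrite rmorph0 scale0r.
apply: (rs_sum_cmp M0 p p) => // i j lin ljn _; rewrite subr0; apply: fM.
have [h1 h2 h3 h4 _] := tagged_partition_in p lin.
by apply/andP; split; lra.
Qed.

(** The endpoints may be moved within a region where E x is constant. *)
Lemma is_rs_integral_eq a b a' b' f x z z' A B :
  unif_cont_on A B f -> a <= b -> a' <= b' ->
  A <= a -> b <= B -> A <= a' -> b' <= B ->
  E a x = E a' x -> E b x = E b' x ->
  is_rs_integral c E f a b x z -> is_rs_integral c E f a' b' x z' -> z = z'.
Proof.
move=> uf ab ab' Aa bB Aa' bB' Ea Eb hz hz'.
apply/eqP; rewrite -subr_eq0; apply/eqP; apply: (@rnorm_eq0 _ _ c).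
apply/eqP; rewrite eq_le rnorm_ge0 andbT; apply/ler_addgt0Pr => e e0.
rewrite add0r.
have e30 : 0 < e / 3 by rewrite divr_gt0.
have e4 : 0 < e / 3 / (nm x + 1) by rewrite divr_gt0 // ltr_wpDl ?rnorm_ge0.
have [d1 d10 h1] := hz _ e30; have [d2 d20 h2] := hz' _ e30.
have [d3 d30 h3] := uf _ e4.
pose d := Num.min (Num.min d1 d2) (d3 / 2).
have d0 : 0 < d by rewrite !lt_min d10 d20 divr_gt0.
have [N /(_ _ (leqnn _)) p] := even_partition ab d0.
have [N' /(_ _ (leqnn _)) p'] := even_partition ab' d0.
have dd1 : d <= d1 by rewrite /d !ge_min lexx.
have dd2 : d <= d2 by rewrite /d !ge_min lexx orbT.
have dd3 : d <= d3 / 2 by rewrite /d !ge_min lexx !orbT.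
have l1 := h1 _ _ _ (tagged_partition_mesh dd1 p).
have l2 := h2 _ _ _ (tagged_partition_mesh dd2 p').
have l3 := rs_sum_cmp (ltW e4) p p' Ea Eb (f := f) (f' := f).
set S := rs_sum _ _ _ _ _ _ _ in l1 l3.
set S' := rs_sum _ _ _ _ _ _ _ in l2 l3.
have {}l3 : nm (S - S') <= e / 3.
  apply: le_trans (l3 _) _ => [i j iN jN ij|].
    have [q1 q2 q3 q4 _] := tagged_partition_in p iN.
    have [r1 r2 r3 r4 _] := tagged_partition_in p' jN.
    by apply/ltW/h3; [apply/andP; split| apply/andP; split |]; lra.
  rewrite mulrAC -ler_pdivlMr ?invr_gt0 ?ltr_wpDl ?rnorm_ge0 // invrK.
  by rewrite ler_pM2l // lerDl.
have -> : z - z' = (z - S) + ((S - S') + (S' - z')).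
  by rewrite addrA subrKA addrA subrK.
have := rnormD c (z - S) ((S - S') + (S' - z')).
have := rnormD c (S - S') (S' - z').
rewrite (rnormB _ z S); lra.
Qed.

(** The sums over even partitions converge to the integral; as sequences in X,
    they make limit arguments available. *)
Definition even_sum f a b x k :=
  rs_sum c E f x k.+1 (even_point a b k.+1) (even_point a b k.+1).

Lemma even_sum_cvg f a b x z : a <= b ->
  is_rs_integral c E f a b x z -> even_sum f a b x k @[k --> \oo] --> z.
Proof.
move=> ab hz; apply/(rnorm_cvgP c) => e /hz[d d0 hd].
have [N hN] := even_partition ab d0.
by exists N => // k /= Nk; apply: hd; exact: hN.
Qed.

(** Sums over fine partitions are close to each other, so that the even sums
    are Cauchy. *)
Lemma is_rs_integral_ex f a b x : a <= b -> unif_cont_on a b f ->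
  exists z, is_rs_integral c E f a b x z.
Proof.
move=> ab uf.
have cmp e : 0 < e -> exists2 d, 0 < d & forall n t s n' t' s',
    tagged_partition a b d n t s -> tagged_partition a b d n' t' s' ->
    nm (rs_sum c E f x n t s - rs_sum c E f x n' t' s') < e.
  move=> e0; have x0 : 0 < nm x + 1 by rewrite ltr_wpDl ?rnorm_ge0.
  have e4 : 0 < e / (nm x + 1) by rewrite divr_gt0.
  have [d d0 hd] := uf _ e4; exists (d / 2); first by rewrite divr_gt0.
  move=> n t s n' t' s' p p'.
  apply: (@le_lt_trans _ _ (e / (nm x + 1) * nm x)); last first.
    by rewrite mulrAC ltr_pdivrMr // ltr_pM2l // ltrDl.
  apply: (rs_sum_cmp (ltW e4) p p') => // i j iN jN ij.
  have [q1 q2 q3 q4 _] := tagged_partition_in p iN.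
  have [r1 r2 r3 r4 _] := tagged_partition_in p' jN.
  by apply/ltW/hd; [apply/andP; split| apply/andP; split |]; lra.
have [z hz] : exists z : X, even_sum f a b x @ \oo --> z.
  apply: (rnorm_cauchy (c := c)) => e /cmp[d d0 hd].
  have [N hN] := even_partition ab d0.
  by exists N => i j Ni Nj; apply: hd; exact: hN.
exists z => e e0; have e20 : 0 < e / 2 by rewrite divr_gt0.
have [d d0 hd] := cmp _ e20; exists d => // n t s p.
have [N hN] := even_partition ab d0.
have /(rnorm_cvgP c)/(_ _ e20)[N' _ hN'] := hz.
have := hN' _ (leq_maxr N N'); set k := maxn N N' => kz.
have kp := hd _ _ _ _ _ _ p (hN _ (leq_maxl N N')).
have := rnormD c (rs_sum c E f x n t s - even_sum f a b x k)
                 (even_sum f a b x k - z).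
rewrite subrKA; rewrite /even_sum -/k in kp kz *; lra.
Qed.

Lemma rs_integralP f a b x : a <= b -> unif_cont_on a b f ->
  is_rs_integral c E f a b x (rs_integral c E f a b x).
Proof. by move=> ab uf; apply: xgetPex; exact: is_rs_integral_ex. Qed.

Lemma rs_integral_eq f a b a' b' x A B :
  unif_cont_on A B f -> a <= b -> a' <= b' ->
  A <= a -> b <= B -> A <= a' -> b' <= B ->
  E a x = E a' x -> E b x = E b' x ->
  rs_integral c E f a b x = rs_integral c E f a' b' x.
Proof.
move=> uf ab ab' Aa bB Aa' bB' Ea Eb.
apply: (is_rs_integral_eq uf ab ab' Aa bB Aa' bB' Ea Eb).
  exact/rs_integralP/(unif_cont_sub _ _ uf).
exact/rs_integralP/(unif_cont_sub _ _ uf).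
Qed.

End SpectralFamily.

(** * Spectral support and functional calculus *)

Section SpectralSupport.
Variables (R : realType) (K : numFieldType) (c : rclike R K).
Variables (X : completeNormedModType K) (ip : {dot X for rc_conj c}).
Hypothesis hX : hilbert ip.
Variables (A : X -> X) (E : R -> X -> X).
Hypothesis hAE : is_spectral_family_of ip A E.
Local Notation inj := (rc_inj c).
Local Notation nm := (@rnorm R K c X).
Local Notation rp := (rip ip).
Local Notation inc := (spectral_incr E).
Implicit Types (x y z u : X) (a b l m : R).

Let hE : spectral_family ip E := hAE.1.

(** Where u has no spectral mass, i.e. where the sign of s - l is that of [sg],
    the increments of u vanish. For the others, [sg * (t i - l)] is at most the
    mesh. The two signs give the upper and the lower bound for the form of A. *)
Lemma rs_integral_form_le (sg : R) l u a b : `|sg| = 1 -> a <= b ->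
  (forall a' b', a' <= b' -> (forall s, a' <= s <= b' -> 0 < sg * (s - l)) ->
     inc a' b' u = 0) ->
  sg * rp (rs_integral c E id a b u - inj l *: inc a b u) u <= 0.
Proof.
move=> sg1 ab hu; apply/ler_addgt0Pr => e e0; rewrite add0r.
have M0 : 0 < nm u + nm u ^+ 2 + 1.
  by rewrite ltr_wpDl // addr_ge0 ?sqr_ge0 ?rnorm_ge0.
pose d := e / (nm u + nm u ^+ 2 + 1).
have d0 : 0 < d by rewrite divr_gt0.
have [d' d'0 hd'] := rs_integralP hX hE u ab (@unif_cont_id R a b) d0.
have dd0 : 0 < Num.min d d' by rewrite lt_min d0.
have [N /(_ _ (leqnn N))] := even_partition ab dd0.
set t := even_point a b N.+1 => p.
have [dl dr] : Num.min d d' <= d /\ Num.min d d' <= d'.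
  by rewrite !ge_min !lexx orbT.
have pd' := hd' _ _ _ (tagged_partition_mesh dr p).
have {}p := tagged_partition_mesh dl p.
set S := rs_sum _ _ _ _ _ _ _ in pd'.
have sumE : \sum_(i < N.+1) inc (t i) (t i.+1) u = inc a b u.
  by rewrite inc_telescope; have [-> ->] := p.
have hS : sg * rp (S - inj l *: inc a b u) u <= d * nm u ^+ 2.
  have -> : S - inj l *: inc a b u =
      \sum_(i < N.+1) inj (t i - l) *: inc (t i) (t i.+1) u.
    rewrite -sumE scaler_sumr -sumrB; apply: eq_bigr => i _.
    by rewrite rmorphB scalerBl.
  have incnn (i : 'I_N.+1) :
      rp (inc (t i) (t i.+1) u) u = nm (inc (t i) (t i.+1) u) ^+ 2.
    rewrite -(ripxx hX) [RHS](inc_sym hE) (inc_sub hE) // ?(partition_le _ p) //.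
    by rewrite ripC.
  have le2 : rp (inc a b u) u <= nm u ^+ 2.
    apply: (le_trans (rip_le hX _ _)); rewrite expr2 ler_wpM2r ?rnorm_ge0 //.
    exact: (inc_le hX hE _ ab).
  rewrite rip_suml mulr_sumr.
  apply: (@le_trans _ _ (d * rp (inc a b u) u)); last by rewrite ler_pM2l.
  rewrite -sumE rip_suml mulr_sumr; apply: ler_sum => i _.
  rewrite ripZl mulrA.
  have [->|n0] := eqVneq (inc (t i) (t i.+1) u) 0; first by rewrite rip0l !mulr0.
  rewrite incnn ler_wpM2r ?sqr_ge0 //.
  have [h1 h2 h3 h4 h5] := tagged_partition_in p (ltn_ord i).
  rewrite leNgt; apply: contra_neqN n0 => dlt; apply: hu; first exact: le_trans h4.
  (* The whole i-th interval lies where u has no spectral mass. *)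
  move=> s /andP[s1 s2]; apply: (@lt_le_trans _ _ (sg * (t i - l) - d)); first lra.
  have : sg * (t i - s) <= `|t i - s|.
    by rewrite -[leRHS]mul1r -sg1 -normrM ler_norm.
  have : `|t i - s| <= d by rewrite ler_norml; lra.
  lra.
have hI : sg * rp (rs_integral c E id a b u - S) u <= d * nm u.
  apply: le_trans (ler_norm _) _; rewrite normrM sg1 mul1r.
  apply: le_trans (rip_abs_le hX _ _) _.
  by rewrite ler_wpM2r ?rnorm_ge0 // ltW // rnormB.
rewrite -(subrKA S) ripDl mulrDr.
apply: le_trans (lerD hI hS) _.
rewrite -mulrDr /d mulrAC ler_pdivrMr // ler_pM2l //.
by rewrite lerDl.
Qed.

(** The limit of [rs_integral_form_le] as the interval grows to the line. *)
Lemma form_le (sg : R) l u : `|sg| = 1 ->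
  (forall a' b', a' <= b' -> (forall s, a' <= s <= b' -> 0 < sg * (s - l)) ->
     inc a' b' u = 0) ->
  sg * rp (A u - inj l *: u) u <= 0.
Proof.
move=> sg1 hu; have [_ _ Em Ep _] := hE.
have lim1 : rs_integral c E id ab.1 ab.2 u - inj l *: inc ab.1 ab.2 u
    @[ab --> (-oo, +oo)] --> A u - inj l *: u.
  apply: cvgB; first exact: hAE.2.
  apply: cvgZl_tmp; rewrite -[X in _ --> X]subr0; apply: cvgB.
    exact: (cvg_comp _ _ cvg_snd (Ep u)).
  exact: (cvg_comp _ _ cvg_fst (Em u)).
have lim2 : sg * rp (rs_integral c E id ab.1 ab.2 u - inj l *: inc ab.1 ab.2 u) u
    @[ab --> (-oo, +oo)] --> sg * rp (A u - inj l *: u) u.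
  by apply: cvgM; [exact: cvg_cst | exact: rip_cvg lim1].
apply: (cvgr_to_le lim2).
exists ([set a | a < 0], [set b | 0 < b]).
  split; [exact: nbhs_ninfty_lt | exact: nbhs_pinfty_gt].
move=> [a b] [/= a0 b0]; apply: rs_integral_form_le => //; lra.
Qed.

(** For l < 0, the vector u = E_l x satisfies 0 <= <A u, u> <= l |u|^2, hence
    vanishes.  The value at l = 0 follows by left continuity. *)
Lemma spectral_low l x : (forall u, 0 <= rp (A u) u) -> l <= 0 -> E l x = 0.
Proof.
move=> A0; have neg m : m < 0 -> E m x = 0.
  move=> m0; have Em : E m (E m x) = E m x by rewrite (spectral_min hE) minxx.
  have : 1 * rp (A (E m x) - inj m *: E m x) (E m x) <= 0.
    apply: form_le => [|a b ab hs]; first exact: normr1.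
    have ma : m < a by have := hs a; rewrite lexx ab => /(_ isT); lra.
    rewrite /spectral_incr !(spectral_min hE) !min_r ?subrr //; lra.
  rewrite mul1r ripBl ripZl (ripxx hX) subr_le0 => h.
  have := le_trans (A0 _) h; rewrite nmulr_rge0 // => h2.
  apply: (@rnorm_eq0 _ _ c); apply/eqP.
  by rewrite -sqrf_eq0 eq_le h2 sqr_ge0.
rewrite le_eqVlt => /orP[/eqP ->|]; last exact: neg.
have [_ _ _ _ /(_ 0 x) left0] := hE.
apply: (cvg_unique _ left0); first exact: norm_hausdorff.
apply: cvg_near_cst; near=> m; apply: neg; near: m; exact: nbhs_left_lt.
Unshelve. all: by end_near. Qed.

(** The vector u = x - E_m x satisfies m |u|^2 <= <A u, u> <= N |u|^2, hence
    vanishes as N < m. *)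
Lemma spectral_high N m x : (forall u, nm (A u) <= N * nm u) -> N < m ->
  E m x = x.
Proof.
move=> AN Nm; apply/esym/eqP; rewrite -subr_eq0; apply/eqP.
set u := x - E m x.
have Eu l : l <= m -> E l u = 0.
  move=> lm; rewrite /u (spectralD hE) (spectralN hE) (spectral_min hE).
  by rewrite min_l // subrr.
have : -1 * rp (A u - inj m *: u) u <= 0.
  apply: form_le => [|a b ab hs]; first exact: normrN1.
  have bm : b < m by have := hs b; rewrite lexx ab => /(_ isT); lra.
  rewrite /spectral_incr !Eu ?subrr //; lra.
rewrite mulN1r oppr_le0 ripBl ripZl (ripxx hX) subr_ge0 => h.
apply: (@rnorm_eq0 _ _ c); apply/eqP; rewrite -sqrf_eq0.
have h2 : rp (A u) u <= N * nm u ^+ 2.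
  apply: le_trans (rip_le hX _ _) _.
  by rewrite expr2 mulrA ler_wpM2r ?rnorm_ge0.
rewrite eq_le sqr_ge0 andbT; have := le_trans h h2.
by rewrite -subr_ge0 -mulrBl nmulr_rge0 ?subr_lt0.
Qed.

Lemma rs_integral_id B x : (forall u, 0 <= rp (A u) u) ->
  (forall x, E B x = x) -> 0 <= B -> rs_integral c E id 0 B x = A x.
Proof.
move=> A0 EB B0; apply: (cvg_unique _ _ (hAE.2 x)); first exact: norm_hausdorff.
apply: cvg_near_cst.
exists ([set a | a < 0], [set b | B < b]).
  split; [exact: nbhs_ninfty_lt | apply: nbhs_pinfty_gt; exact: num_real].
move=> [a b] [/= a0 Bb].
apply: (rs_integral_eq hX hE (@unif_cont_id R a b)) => //;
  [lra | exact: ltW | exact: ltW | |].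
  by rewrite !spectral_low // ltW.
by rewrite -{1}(EB x) (spectral_min hE) min_r ?ltW.
Qed.

End SpectralSupport.

Section FunctionalCalculus.
Variables (R : realType) (K : numFieldType) (c : rclike R K).
Variables (X : completeNormedModType K) (ip : {dot X for rc_conj c}).
Hypothesis hX : hilbert ip.
Variables (E : R -> X -> X) (B : R).
Hypothesis hE : spectral_family ip E.
Hypotheses (B_ge0 : 0 <= B) (E_0 : forall x, E 0 x = 0).
Hypothesis E_B : forall x, E B x = x.
Local Notation inj := (rc_inj c).
Local Notation nm := (@rnorm R K c X).
Local Notation rp := (rip ip).
Local Notation inc := (spectral_incr E).
Implicit Types (f g : R -> R) (x y : X).

Local Notation F f x := (rs_integral c E f 0 B x).
Local Notation S f k x := (even_sum c E f 0 B x k).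
Local Notation cont f := {within `[0, B], continuous f}.

Lemma calculus_cvg f x : cont f -> S f k x @[k --> \oo] --> F f x.
Proof.
move=> cf; apply: even_sum_cvg => //.
exact/(rs_integralP hX hE) /segment_unif_cont.
Qed.
Arguments calculus_cvg {f} x _.

Lemma calculus_unique f x z : cont f -> S f k x @[k --> \oo] --> z -> F f x = z.
Proof.
by move=> cf; apply: norm_cvg_unique; exact: calculus_cvg.
Qed.

Lemma cont_bounded f : cont f ->
  exists2 M, 0 <= M & forall r, 0 <= r <= B -> `|f r| <= M.
Proof.
move=> cf.
have cn : cont (fun r => `|f r|) by move=> r; apply: cvg_norm; exact: cf.
have [m _ hm] := EVT_max B_ge0 cn.
by exists `|f m| => // r hr; apply: hm; rewrite in_itv.
Qed.

Lemma even_sum_bound f (M : R) k x : 0 <= M ->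
  (forall r, 0 <= r <= B -> `|f r| <= M) -> nm (S f k x) <= M * nm x.
Proof.
by move=> M0 hM; exact: (rs_sum_bound hX hE x M0 (even_partition_any k B_ge0)).
Qed.

Lemma calculus_bound f (M : R) x : cont f -> 0 <= M ->
  (forall r, 0 <= r <= B -> `|f r| <= M) -> nm (F f x) <= M * nm x.
Proof.
move=> cf M0 hM; apply: (rnorm_lim_le (calculus_cvg x cf)) => k.
exact: even_sum_bound.
Qed.

Lemma calculusD f x y : cont f -> F f (x + y) = F f x + F f y.
Proof.
move=> cf; apply: calculus_unique => //.
rewrite (_ : (fun k => _) = (fun k => S f k x) \+ (fun k => S f k y)).
  by apply: cvgD; exact: calculus_cvg.
apply/funext => k /=; rewrite /even_sum !rs_sumE -big_split /=.
by apply: eq_bigr => i _; rewrite (incD hE) scalerDr.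
Qed.

Lemma calculus_sub f g x : cont f -> cont g ->
  F (fun r => f r - g r) x = F f x - F g x.
Proof.
move=> cf cg; apply: calculus_unique.
  by move=> r; apply: cvgB; [exact: cf | exact: cg].
rewrite (_ : (fun k => _) = (fun k => S f k x) \- (fun k => S g k x)).
  by apply: cvgB; exact: calculus_cvg.
apply/funext => k /=; rewrite /even_sum !rs_sumE -sumrB /=.
by apply: eq_bigr => i _; rewrite rmorphB scalerBl.
Qed.

Lemma calculus_sym f x y : cont f -> rp (F f x) y = rp x (F f y).
Proof.
move=> cf.
have h1 : rp (S f k x) y @[k --> \oo] --> rp (F f x) y.
  exact: rip_cvg (calculus_cvg x cf).
have h2 : rp (S f k y) x @[k --> \oo] --> rp (F f y) x.
  exact: rip_cvg (calculus_cvg y cf).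
apply: (norm_cvg_unique h1); rewrite ripC.
suff -> : (fun k => rp (S f k x) y) = (fun k => rp (S f k y) x) by [].
apply/funext => k; rewrite /even_sum !rs_sumE !rip_suml; apply: eq_bigr => i _.
by rewrite !ripZl (inc_sym hE) ripC.
Qed.

(** By orthogonality of the increments, sums over one partition multiply
    exactly. *)
Lemma even_sumM f g k x : S f k (S g k x) = S (fun r => f r * g r) k x.
Proof.
rewrite /even_sum !rs_sumE; set t := even_point 0 B k.+1.
have p : tagged_partition 0 B (B - 0 + 1) k.+1 t t by exact: even_partition_any.
apply: eq_bigr => i _; rewrite (inc_sum hE) (bigD1 i) //= big1 ?addr0.
  rewrite (incZ hE) (inc_sub hE) ?(partition_le _ p) //.
  by rewrite scalerA rmorphM.
move=> j ji; rewrite (incZ hE) (inc_partition_disjoint hE _ p) ?scaler0 //.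
by rewrite eq_sym.
Qed.

Lemma calculusM f g x : cont f -> cont g ->
  F f (F g x) = F (fun r => f r * g r) x.
Proof.
move=> cf cg; apply/esym/calculus_unique.
  by move=> r; apply: cvgM; [exact: cf | exact: cg].
have [M M0 hM] := cont_bounded cf.
apply/(rnorm_cvgP c) => e e0; have e20 : 0 < e / 2 by rewrite divr_gt0.
have M1 : 0 < M + 1 by rewrite ltr_wpDl.
have /(rnorm_cvgP c)/(_ _ e20) h1 := calculus_cvg (F g x) cf.
have /(rnorm_cvgP c)/(_ _ (divr_gt0 e20 M1)) h2 := calculus_cvg x cg.
near=> k.
rewrite -even_sumM.
have k1 : nm (S f k (F g x) - F f (F g x)) < e / 2 by near: k; exact: h1.
have k2 : nm (S g k x - F g x) < e / 2 / (M + 1) by near: k; exact: h2.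
have sB : S f k (S g k x) - S f k (F g x) = S f k (S g k x - F g x).
  rewrite /even_sum [RHS]rs_sumE !rs_sumE -sumrB; apply: eq_bigr => i _.
  by rewrite -scalerBr -(scaleN1r (F g x)) (incD hE) (incZ hE) scaleN1r.
rewrite -(subrKA (S f k (F g x))) sB.
apply: le_lt_trans (rnormD c _ _) _.
have := even_sum_bound k (S g k x - F g x) M0 hM.
have k3 : M * nm (S g k x - F g x) <= e / 2.
  apply: (@le_trans _ _ ((M + 1) * nm (S g k x - F g x))).
    by rewrite ler_wpM2r ?rnorm_ge0 // lerDl.
  by rewrite mulrC -ler_pdivlMr // ltW.
lra.
Unshelve. all: by end_near. Qed.

(** The integral up to |A| + e does not depend on the small e > 0, because E is
    constant beyond |A|. *)
Lemma spectral_funE A f x : spectral_family_of ip A = E ->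
  (forall m x, opnorm c A < m -> E m x = x) -> 0 <= opnorm c A < B ->
  cont f -> spectral_fun ip A f x = F f x.
Proof.
move=> EA Ehigh /andP[A0 AB] cf; rewrite /spectral_fun EA.
apply: cvg_lim; first exact: norm_hausdorff.
apply: cvg_near_cst; near=> e.
have e0 : 0 < e by near: e; exact: nbhs_right_gt.
have eB : e < B - opnorm c A.
  by near: e; apply: nbhs_right_lt; rewrite subr_gt0.
apply: (rs_integral_eq hX hE (segment_unif_cont cf)) => //; [lra | lra |].
by rewrite E_B Ehigh // ltrDl.
Unshelve. all: by end_near. Qed.

End FunctionalCalculus.

(** Used for the default family, which stands in for a missing one. *)
Lemma rs_integral_zero (R : realType) (K : numFieldType) (c : rclike R K)
    (X : completeNormedModType K) (f : R -> R) (a b : R) (x : X) : a <= b ->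
  rs_integral c (fun _ _ => 0) f a b x = 0.
Proof.
move=> ab; rewrite /rs_integral; case: xgetP => // z _ hz.
apply: (@rnorm_eq0 _ _ c); apply/eqP; rewrite eq_le rnorm_ge0 andbT.
apply/ler_addgt0Pr => e /hz[d d0 hd]; rewrite add0r.
have [N /(_ _ (leqnn N))/hd] := even_partition ab d0.
rewrite /rs_sum big1 => [|i _]; last by rewrite subrr scaler0.
by rewrite sub0r rnormN => /ltW.
Qed.

(** * Scalar estimates *)

Section ScalarEstimates.
Variable R : realType.
Implicit Types a b d l p s x y : R.

Lemma powR_expR x p : 0 < x -> x `^ p = expR (p * ln x).
Proof. by move=> x0; rewrite /powR gt_eqF. Qed.

Lemma powRN_anti p x y : 0 <= p -> 0 < x -> x <= y -> y `^ (- p) <= x `^ (- p).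
Proof.
move=> p0 x0 xy; have y0 := lt_le_trans x0 xy.
rewrite !powRN lef_pV2 ?posrE ?powR_gt0 //.
by rewrite ge0_ler_powR // nnegrE ltW.
Qed.

Lemma continuous_powR x s : 0 < x -> {for x, continuous (fun y => y `^ s)}.
Proof.
move=> x0; apply: differentiable_continuous; apply/derivable1_diffP.
by apply: derivable_powR; rewrite in_itv /= x0.
Qed.

(** The functions of the calculus are given by powers and logarithms, regular
    for x > 0 only; at 0 they are continuous by monotonicity of the power. *)
Lemma within_continuous0 (B : R) (f : R -> R) :
  (forall x, 0 < x <= B -> {for x, continuous f}) ->
  (forall e, 0 < e -> exists2 r, 0 < r &
     forall y, 0 < y < r -> `|f y - f 0| < e) ->
  {within `[0, B], continuous f}.
Proof.
move=> fc f0; apply/subspace_continuousP => x /=; rewrite in_itv /= => /andP[].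
rewrite le_eqVlt => /orP[/eqP <- _|x0 xB]; last first.
  by apply: cvg_within_filter; apply: fc; rewrite x0.
apply/cvgrPdist_lt => e e0; have [r r0 hr] := f0 e e0.
rewrite near_withinE; exists r => // y /=; rewrite sub0r normrN in_itv /= => yr.
case/andP; rewrite le_eqVlt => /orP[/eqP <- _|y0 _]; first by rewrite subrr normr0.
by rewrite distrC; apply: hr; rewrite y0 (le_lt_trans (ler_norm _) yr).
Qed.

Lemma powR_within_continuous (B : R) s : 0 < s ->
  {within `[0, B], continuous (fun y => y `^ s)}.
Proof.
move=> s0; apply: within_continuous0 => [x /andP[x0 _]|e e0].
  exact: continuous_powR.
exists (e `^ s^-1) => [|y /andP[y0 ye]]; first exact: powR_gt0.
rewrite powR0 ?gt_eqF // subr0 ger0_norm ?powR_ge0 //.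
have -> : e = (e `^ s^-1) `^ s by rewrite -powRrM mulVf ?gt_eqF // powRr1 ?ltW.
by rewrite gt0_ltr_powR // nnegrE ltW // powR_gt0.
Qed.

Lemma f_log_ge0 p l : 0 <= f_log p l.
Proof. exact: powR_ge0. Qed.

Lemma f_log0 p : 0 < p -> f_log p 0 = 0.
Proof. by move=> p0; rewrite /f_log ln0 // oppr0 powR0 // oppr_eq0 gt_eqF. Qed.

Lemma f_log_within_continuous (B : R) p : 0 < p -> B < 1 ->
  {within `[0, B], continuous (f_log p)}.
Proof.
move=> p0 B1; apply: within_continuous0 => [x /andP[x0 xB]|e e0].
  apply: (@continuous_comp _ _ _ (fun y => - ln y) (fun y => y `^ (- p))).
    by apply: cvgN; exact: continuous_ln.
  by apply: continuous_powR; rewrite oppr_gt0 ln_lt0 // x0 (le_lt_trans xB).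
pose M := e `^ (- p^-1); have M0 : 0 < M by exact: powR_gt0.
exists (expR (- M)) => [|y /andP[y0 yM]]; first exact: expR_gt0.
rewrite f_log0 // subr0 ger0_norm ?f_log_ge0 //.
have My : M < - ln y by rewrite ltrNr -(expRK (- M)) ltr_ln ?posrE ?expR_gt0.
have -> : e = M `^ (- p).
  by rewrite /M -powRrM mulrNN mulVf ?gt_eqF // powRr1 ?ltW.
rewrite /f_log !powRN ltf_pV2 ?posrE ?powR_gt0 // ?(lt_trans M0) //.
by rewrite gt0_ltr_powR // nnegrE ?ltW // (lt_trans M0).
Qed.

Lemma g_filter_denom_gt0 (al l : R) : 0 < al -> 0 <= l ->
  0 < l + (1 - l `^ Num.sqrt al) ^+ 2.
Proof.
move=> a0; rewrite le_eqVlt => /orP[/eqP <-|l0]; last by rewrite ltr_wpDr ?sqr_ge0.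
by rewrite powR0 ?gt_eqF ?sqrtr_gt0 // subr0 expr1n add0r.
Qed.

Lemma g_filter_within_continuous (B al : R) : 0 < al ->
  {within `[0, B], continuous (g_filter al)}.
Proof.
move=> a0; have cp := @powR_within_continuous B (Num.sqrt al).
rewrite sqrtr_gt0 in cp; move: cp => /(_ a0)/subspace_continuousP cp.
apply/subspace_continuousP => x xB; rewrite /g_filter; apply: cvgV.
  by rewrite gt_eqF // g_filter_denom_gt0 //; move: xB; rewrite /= in_itv => /andP[].
apply: cvgD; first exact: cvg_within.
have cq : 1 - y `^ Num.sqrt al @[y --> within `[0, B] (nbhs x)]
    --> 1 - x `^ Num.sqrt al.
  by apply: cvgB; [exact: cvg_cst | exact: cp].
exact: (cvgM cq cq).
Qed.

(** The bound on sqrt(l) g(l), squared: this is the form in which the calculus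
    uses it.  The lower bound on q needs l away from 1, where q vanishes. *)
Lemma g_filter_sqrt_bound (al l : R) : 0 < al < 1 -> 0 <= l <= expR (- 2^-1) ->
  l * g_filter al l ^+ 2 <= (2 / Num.sqrt al) ^+ 2.
Proof.
move=> /andP[a0 a1] /andP[l0 lB]; set s := Num.sqrt al.
have s0 : 0 < s by rewrite sqrtr_gt0.
have s1 : s < 1 by rewrite -sqrtr1 ltr_sqrt.
have D0 := g_filter_denom_gt0 a0 l0; rewrite -/s in D0.
rewrite /g_filter -/s.
set q := 1 - l `^ s in D0 *.
(* 1 - exp(-s/2) >= (s/2) / (1 + s/2) >= s/3, as s <= 1. *)
have qs : s / 3 <= q.
  have : l `^ s <= (1 + s / 2)^-1.
    apply: (@le_trans _ _ (expR (- 2^-1) `^ s)).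
      by rewrite ge0_ler_powR ?nnegrE ?expR_ge0 ?(ltW s0).
    rewrite -expRM mulNr expRN lef_pV2 ?posrE ?expR_gt0 //; last lra.
    by rewrite mulrC; exact: expR_ge1Dx.
  have : (1 + s / 2)^-1 <= 1 - s / 3.
    by rewrite -div1r ler_pdivrMr; nra.
  rewrite /q; lra.
set X := l + q ^+ 2 in D0 *; pose u := Num.sqrt l.
have u0 : 0 <= u by exact: sqrtr_ge0.
have lu : l = u ^+ 2 by rewrite /u sqr_sqrtr.
have uX : u / X <= 2 / s.
  rewrite ler_pdivrMr // mulrAC ler_pdivlMr // /X lu.
  have q3 : 0 <= 3 * q - s by lra.
  have := mulr_ge0 u0 q3; have := sqr_ge0 (u - q); nra.
have -> : l * X^-1 ^+ 2 = (u / X) ^+ 2 by rewrite exprMn -lu.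
by rewrite ler_pXn2r // nnegrE divr_ge0 // ltW.
Qed.

(** The inequality t <= exp t at t = a / (2 p), to the power p. *)
Lemma powR_expR_bound p a : 0 < p -> 0 < a ->
  a `^ p <= (2 * p) `^ p * expR (a / 2).
Proof.
move=> p0 a0; have pp : 0 < 2 * p by rewrite mulr_gt0.
have -> : a / 2 = a / (2 * p) * p by field; rewrite gt_eqF.
rewrite expRM -powRM ?expR_ge0 ?(ltW pp) //.
apply: ge0_ler_powR; rewrite ?nnegrE ?(ltW p0) ?(ltW a0) //.
  by rewrite mulr_ge0 ?expR_ge0 // ltW.
rewrite mulrC -ler_pdivrMr //; apply: le_trans (expR_ge1Dx _).
by rewrite lerDr.
Qed.

(** The constant is the sum of those of the cases L >= a/2 and L < a/2 of
    [residual_bound]. *)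
Definition residual_const p : R := 2 `^ p * (1 + (2 * (p + 2)) `^ (p + 2)).

(** Large L is controlled by the decay of f_log, small L by the residual
    q^2 / (l + q^2) <= q^2 / l. *)
Lemma residual_bound p (al l : R) :
  0 < p -> 0 < al < 1 -> 0 <= l <= expR (- 2^-1) ->
  `|f_log p l - g_filter al l * (l * f_log p l)|
    <= residual_const p * (- ln al) `^ (- p).
Proof.
move=> p0 /andP[a0 a1] /andP[l0 lB].
set a := - ln al.
have agt0 : 0 < a by rewrite oppr_gt0 ln_lt0 // a0.
have C0 : 0 <= residual_const p by rewrite mulr_ge0 ?addr_ge0 ?powR_ge0.
move: l0; rewrite le_eqVlt => /orP[/eqP <-|l0].
  by rewrite f_log0 // !mulr0 subrr normr0 mulr_ge0 ?powR_ge0.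
set L := - ln l.
have L12 : 2^-1 <= L by rewrite lerNr -(expRK (- 2^-1)) ler_ln ?posrE ?expR_gt0.
have L0 : 0 < L by apply: lt_le_trans L12; rewrite invr_gt0.
set s := Num.sqrt al.
have s0 : 0 < s by rewrite sqrtr_gt0.
have lE : l = expR (- L) by rewrite /L opprK lnK.
have alE : al = expR (- a) by rewrite /a opprK lnK.
have sE : s = expR (- (a / 2)).
  rewrite /s alE (_ : expR (- a) = expR (- (a / 2)) ^+ 2).
    by rewrite sqrtr_sqr ger0_norm ?expR_ge0.
  by rewrite expr2 -expRD; congr expR; field.
have s0' := ltW s0; have L0' := ltW L0; have agt0' := ltW agt0.
have D0 := g_filter_denom_gt0 a0 (ltW l0); rewrite -/s in D0.
have D0' := ltW D0.
set q := 1 - l `^ s in D0 D0'.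
have q0 : 0 <= q.
  by rewrite subr_ge0 lE -expRM expR_le1 mulNr oppr_le0 mulr_ge0.
have qsL : q <= s * L.
  have := expR_ge1Dx (- L * s); rewrite /q lE -expRM; lra.
have -> : f_log p l - g_filter al l * (l * f_log p l) =
    q ^+ 2 / (l + q ^+ 2) * L `^ (- p).
  rewrite /g_filter -/s -/q /f_log -/L; field; by rewrite gt_eqF.
have q20 : 0 <= q ^+ 2 / (l + q ^+ 2) by rewrite divr_ge0 ?sqr_ge0.
rewrite (ger0_norm (mulr_ge0 q20 (powR_ge0 _ _))).
have [La|La] := leP (a / 2) L.
  apply: (@le_trans _ _ (1 * (a / 2) `^ (- p))).
    apply: ler_pM; rewrite ?powR_ge0 //.
      by rewrite ler_pdivrMr // mul1r lerDr ltW.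
    by apply: powRN_anti; rewrite ?divr_gt0 // ltW.
  rewrite mul1r powRM ?invr_ge0 // mulrC ler_wpM2r ?powR_ge0 //.
  rewrite -powR_inv1 // -powRrM mulrNN mul1r.
  by rewrite ler_peMr ?powR_ge0 // lerDl powR_ge0.
have sl : s <= l by rewrite sE lE ler_expR lerN2 ltW.
have r1 : q ^+ 2 / (l + q ^+ 2) <= s * a ^+ 2.
  rewrite ler_pdivrMr //.
  have h1 : q ^+ 2 <= (s * L) ^+ 2 by rewrite ler_pXn2r ?nnegrE ?mulr_ge0.
  have h2 : (s * L) ^+ 2 <= (s * a) ^+ 2.
    by rewrite ler_pXn2r ?nnegrE ?mulr_ge0 ?ler_pM2l //; lra.
  have h3 : s * a ^+ 2 * s <= s * a ^+ 2 * (l + q ^+ 2).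
    rewrite ler_wpM2l ?mulr_ge0 ?sqr_ge0 //.
    by rewrite (le_trans sl) // lerDl sqr_ge0.
  apply: le_trans h1 _; apply: le_trans h2 _; apply: le_trans h3.
  by rewrite le_eqVlt; apply/orP; left; apply/eqP; ring.
have r2 : L `^ (- p) <= 2 `^ p.
  have -> : 2 `^ p = 2^-1 `^ (- p) :> R.
    by rewrite -powR_inv1 // -powRrM mulrNN mul1r.
  by apply: powRN_anti; rewrite ?invr_gt0 ?(ltW p0).
apply: (@le_trans _ _ (s * a ^+ 2 * 2 `^ p)).
  by apply: ler_pM => //; exact: powR_ge0.
rewrite mulrC -mulrA ler_wpM2l ?powR_ge0 //.
apply: (@le_trans _ _ ((2 * (p + 2)) `^ (p + 2) * a `^ (- p))); last first.
  by rewrite ler_wpM2r ?powR_ge0 // lerDr.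
have p20 : 0 < p + 2 by rewrite addr_gt0.
have := powR_expR_bound p20 agt0.
rewrite powRD ?gt_eqF ?implybT // -(powR_mulrn 2) // => h.
rewrite sE expRN mulrC ler_pdivrMr ?expR_gt0 // mulrAC powRN.
by rewrite ler_pdivlMr ?powR_gt0 // mulrC.
Qed.

(** In the variable a = - ln l, solving Theta p l = d becomes solving
    a/2 + p ln a = - ln d. *)
Lemma Theta_expE p a : 0 < a -> Theta p (expR (- a)) = expR (- (a / 2 + p * ln a)).
Proof.
move=> a0; rewrite /Theta -expRN opprK expRK powR_expR // opprD expRD mulNr.
congr (_ * _); rewrite (_ : expR (- a) = expR (- (a / 2)) ^+ 2).
  by rewrite sqrtr_sqr ger0_norm ?expR_ge0.
by rewrite expr2 -expRD; congr expR; field.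
Qed.

(** The intermediate value theorem on [1, 2 D], for D = - ln d >= 1/2. *)
Lemma Theta_surj p d : 0 < p -> 0 < d <= expR (- 2^-1) ->
  exists l, 0 < l < 1 /\ Theta p l = d.
Proof.
move=> p0 /andP[d0 dB]; pose D := - ln d.
have D12 : 2^-1 <= D by rewrite lerNr -(expRK (- 2^-1)) ler_ln ?posrE ?expR_gt0.
have dD : d = expR (- D) by rewrite /D opprK lnK.
pose h a := a / 2 + p * ln a.
have D1 : 1 <= 2 * D by lra.
have hc : {within `[1, 2 * D], continuous h}.
  apply/subspace_continuousP => x; rewrite /= in_itv => /andP[x1 _].
  apply: cvg_within_filter; apply: cvgD; apply: cvgM.
  - exact: cvg_id.
  - exact: cvg_cst.
  - exact: cvg_cst.
  - by apply: continuous_ln; exact: lt_le_trans ltr01 x1.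
have h1 : h 1 = 2^-1 by rewrite /h ln1 mulr0 addr0 mul1r.
have h2 : D <= h (2 * D).
  have := mulr_ge0 (ltW p0) (ln_ge0 D1); rewrite /h; lra.
have [|a] := @IVT R h 1 (2 * D) D D1 hc.
  by rewrite h1 ge_min le_max D12 h2 orbT.
rewrite in_itv /= => /andP[a1 _] ha; have a0 := lt_le_trans ltr01 a1.
exists (expR (- a)); rewrite expR_gt0 expR_lt1 oppr_lt0 a0; split=> //.
by rewrite Theta_expE // dD -ha.
Qed.

Lemma Theta_invP p d : 0 < p -> 0 < d <= expR (- 2^-1) ->
  0 < Theta_inv p d < 1 /\ Theta p (Theta_inv p d) = d.
Proof.
move=> p0 /(Theta_surj p0) h.
exact: (@xgetPex _ 0 [set l | 0 < l < 1 /\ Theta p l = d] h).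
Qed.

Lemma noise_rate p (al d : R) : 0 < al < 1 -> Theta p al = d ->
  d / Num.sqrt al = (- ln al) `^ (- p).
Proof.
move=> /andP[a0 a1] <-; rewrite /Theta lnV ?posrE // mulrAC divff ?mul1r //.
by rewrite gt_eqF // sqrtr_gt0.
Qed.

(** Here - ln d = a/2 + p ln a <= (1/2 + p) a for a = - ln al. *)
Lemma rate_f_log p (al d : R) : 0 < p -> 0 < al < 1 -> Theta p al = d ->
  0 < d < 1 -> (- ln al) `^ (- p) <= (2^-1 + p) `^ p * f_log p d.
Proof.
move=> p0 /andP[a0 a1] dE d01.
set a := - ln al; have agt0 : 0 < a by rewrite oppr_gt0 ln_lt0 // a0.
have alE : al = expR (- a) by rewrite /a opprK lnK.
have dE' : - ln d = a / 2 + p * ln a by rewrite -dE alE Theta_expE // expRK opprK.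
have D0 : 0 < - ln d by rewrite oppr_gt0 ln_lt0.
have c0 : 0 < 2^-1 + p by rewrite addr_gt0 // invr_gt0.
have le : - ln d <= (2^-1 + p) * a.
  have := ln_sublinear agt0; rewrite dE' => /ltW h.
  have := ler_wpM2l (ltW p0) h; lra.
have := powRN_anti (ltW p0) D0 le; rewrite powRM ?(ltW c0) ?(ltW agt0) // powRN => h.
by rewrite -ler_pdivrMl ?powR_gt0.
Qed.

End ScalarEstimates.

(** * Error estimate *)

Section ErrorEstimate.
Variables (R : realType) (K : numFieldType) (c : rclike R K).
Variables (X Y : completeNormedModType K).
Variables (ipX : {dot X for rc_conj c}) (ipY : {dot Y for rc_conj c}).
Hypotheses (hX : hilbert ipX) (hY : hilbert ipY).
Variable T : {linear X -> Y}.
Hypothesis T_bnd : bounded_operator c T.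
Local Notation nm := (rnorm c).
Local Notation rp := (rip ipX).
Local Notation A := (normal_op ipX ipY T).
Local Notation Tadj := (adjoint ipX ipY T).

Section WithSpectralFamily.
Variables (E : R -> X -> X) (B : R).
Hypothesis hAE : is_spectral_family_of ipX A E.
Hypotheses (B_ge0 : 0 <= B) (E_B : forall x, E B x = x).
Local Notation F f x := (rs_integral c E f 0 B x).
Local Notation cont f := {within `[0, B], continuous f}.
Let hE : spectral_family ipX E := hAE.1.

Lemma normal_op_form_ge0 (u : X) : 0 <= rp (A u) u.
Proof. by rewrite (normal_op_ge0 hX hY T_bnd) sqr_ge0. Qed.

Lemma calculus_id x : F id x = A x.
Proof. exact: (rs_integral_id hX hAE x normal_op_form_ge0 E_B B_ge0). Qed.

Lemma cont_id : cont (@id R).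
Proof. by apply: continuous_subspaceT => x; exact: cvg_id. Qed.

Lemma contM (f g : R -> R) : cont f -> cont g -> cont (fun r => f r * g r).
Proof. by move=> cf cg r; apply: cvgM; [exact: cf | exact: cg]. Qed.

(** For u = g(A) T^* v, we have |u|^2 = <T g(A) u, v> (the inner product of Y),
    and |T g(A) u|^2 = <A g(A) u, g(A) u> = <(id g^2)(A) u, u> <= M^2 |u|^2. *)
Lemma noise_propagation (g : R -> R) (M : R) (v : Y) : cont g -> 0 <= M ->
  (forall l, 0 <= l <= B -> l * g l ^+ 2 <= M ^+ 2) ->
  nm (F g (Tadj v)) <= M * nm v.
Proof.
move=> cg M0 gM; set u := F g (Tadj v); set h := F g u.
have Th : nm (T h) <= M * nm u.
  rewrite -(ler_pXn2r (n := 2)) ?nnegrE ?mulr_ge0 ?rnorm_ge0 //.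
  rewrite -(normal_op_ge0 hX hY T_bnd) -calculus_id.
  rewrite -(calculus_sym hX hE B_ge0 _ _ cg).
  rewrite (calculusM hX hE B_ge0 _ cont_id cg).
  rewrite (calculusM hX hE B_ge0 _ cg (contM cont_id cg)).
  apply: le_trans (rip_le hX _ _) _.
  rewrite exprMn expr2 (expr2 (nm u)) mulrA ler_wpM2r ?rnorm_ge0 //.
  apply: (calculus_bound hX hE B_ge0); first exact: (contM cg (contM cont_id cg)).
    by rewrite mulr_ge0.
  move=> l /[dup] lB /andP[l0 _].
  rewrite (_ : g l * (l * g l) = l * g l ^+ 2); last by ring.
  by rewrite ger0_norm ?(mulr_ge0 l0) ?sqr_ge0 // -[leRHS]expr2 gM.
have [u0|un0] := eqVneq (nm u) 0; first by rewrite u0 mulr_ge0 ?rnorm_ge0.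
have ugt0 : 0 < nm u by rewrite lt_neqAle eq_sym un0 rnorm_ge0.
rewrite -(ler_pM2l ugt0) -expr2 -(ripxx hX) {1}/u.
rewrite (calculus_sym hX hE B_ge0 _ _ cg) ripC -(rip_adjoint hX hY T_bnd).
apply: le_trans (rip_le hY _ _) _.
by rewrite mulrA (mulrC (nm u)) ler_wpM2r ?rnorm_ge0.
Qed.

Lemma error_decomposition (f g : R -> R) (w : X) (y : Y) : cont f -> cont g ->
  F g (Tadj y) - F f w = F g (Tadj (y - T (F f w)))
                         - F (fun l => f l - g l * (l * f l)) w.
Proof.
move=> cf cg.
have -> : Tadj y = A (F f w) + Tadj (y - T (F f w)).
  by rewrite (adjointB hX hY T_bnd) addrC subrK.
rewrite (calculusD hX hE B_ge0 _ _ cg) -calculus_id.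
rewrite (calculusM hX hE B_ge0 _ cont_id cf).
rewrite (calculusM hX hE B_ge0 _ cg (contM cont_id cf)).
rewrite (calculus_sub hX hE B_ge0 _ cf (contM cg (contM cont_id cf))).
by rewrite opprB addrCA addrA.
Qed.

End WithSpectralFamily.

Hypothesis TT_norm : opnorm c A <= expR (-1).

(** The constant depends neither on w nor on the data, which gives both the
    rate for a single solution and the worst-case rate. The endpoint exp(-1/2)
    is any point strictly between exp(-1), which bounds |A|, and the
    singularity 1 of f_log. *)
Lemma uniform_error_bound p rho : 0 < p -> 0 < rho ->
  exists2 C, 0 <= C & forall d, 0 < d <= expR (- 2^-1) ->
    forall xdag yd, log_source_set ipX ipY T p rho xdag ->
      nm (yd - T xdag) <= d ->
      nm (reg_method ipX ipY T p d yd - xdag) <= C * f_log p d.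
Proof.
move=> p0 rho0.
have [A0 Abnd] := opnorm_normal_op hX hY T_bnd.
pose B : R := expR (- 2^-1).
have B0 : 0 <= B by exact: expR_ge0.
have AB : opnorm c A < B.
  by apply: le_lt_trans TT_norm _; rewrite ltr_expR; lra.
pose C := (2 + residual_const p * rho) * (2^-1 + p) `^ p.
have res0 : 0 <= residual_const p by rewrite mulr_ge0 ?addr_ge0 ?powR_ge0.
have C10 : 0 <= 2 + residual_const p * rho.
  by rewrite addr_ge0 // mulr_ge0 // ltW.
have C0 : 0 <= C := mulr_ge0 C10 (powR_ge0 _ _).
exists C => // d dB xdag yd [w /= wrho xdagE] ydd.
have [d0 _] := andP dB.
have := xgetP (fun _ _ => 0) [set E | is_spectral_family_of ipX A E].
rewrite -/(spectral_family_of ipX A); case=> [E EA hAE|none]; last first.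
  have EA : spectral_family_of ipX A = (fun _ _ => 0).
    by rewrite /spectral_family_of xgetPN.
  have sf0 f x : spectral_fun ipX A f x = 0.
    rewrite /spectral_fun EA; apply: cvg_lim; first exact: norm_hausdorff.
    apply: cvg_near_cst; near=> e; apply: rs_integral_zero.
    by rewrite addr_ge0.
  rewrite -xdagE /reg_method !sf0 subrr rnorm0 mulr_ge0 ?f_log_ge0 //.
have hE : spectral_family ipX E := hAE.1.
have E0 x : E 0 x = 0.
  by apply: (spectral_low hX hAE) => // u; exact: normal_op_form_ge0.
have Ehigh m x : opnorm c A < m -> E m x = x.
  exact: (spectral_high hX hAE).
have EB x : E B x = x by exact: Ehigh.
have sf f x : {within `[0, B], continuous f} ->
    spectral_fun ipX A f x = rs_integral c E f 0 B x.
  by move=> cf; apply: (spectral_funE hX hE) => //; rewrite A0.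
have B1 : B < 1 by rewrite expR_lt1 oppr_lt0 invr_gt0.
have cf := f_log_within_continuous p0 B1.
have [al01 alE] := Theta_invP p0 dB.
set al := Theta_inv p d in al01 alE.
have [al0 _] := andP al01.
have cg := @g_filter_within_continuous _ B _ al0.
rewrite /reg_method -/al sf // -xdagE sf // in ydd *.
rewrite (error_decomposition hAE B0 EB _ _ cf cg).
apply: le_trans (rnormD c _ _) _; rewrite rnormN.
have d1 : d < 1 by case/andP: dB => _ /le_lt_trans; apply.
have s0 : 0 <= 2 / Num.sqrt al by rewrite divr_ge0 ?sqrtr_ge0.
have h1 := noise_propagation hAE B0 EB (yd - T (rs_integral c E (f_log p) 0 B w))
  cg s0 (fun l lB => g_filter_sqrt_bound al01 lB).
have r0 : 0 <= (- ln al) `^ (- p) by exact: powR_ge0.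
have cres : {within `[0, B], continuous
    (fun l => f_log p l - g_filter al l * (l * f_log p l))}.
  have := contM cg (contM (@cont_id _) cf).
  by move=> ch r; apply: cvgB; [exact: cf | exact: ch].
have h2 := calculus_bound hX hE B0 w cres (mulr_ge0 res0 r0)
  (fun l lB => residual_bound p0 al01 lB).
apply: (@le_trans _ _ ((2 + residual_const p * rho) * (- ln al) `^ (- p))).
  rewrite mulrDl; apply: lerD.
    apply: le_trans h1 _; rewrite -(noise_rate al01 alE) mulrAC -mulrA.
    by rewrite ler_pM2l // ler_wpM2r ?invr_ge0 ?sqrtr_ge0.
  by apply: le_trans h2 _; rewrite mulrAC ler_wpM2r // ler_wpM2l.
have d01 : 0 < d < 1 by rewrite d0.
by apply: le_trans (ler_wpM2l C10 (rate_f_log p0 al01 alE d01)) _; rewrite mulrA.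
Unshelve. all: by end_near. Qed.

End ErrorEstimate.

Theorem theorem2 (R : realType) (K : numFieldType) (c : rclike R K)
    (X Y : completeNormedModType K)
    (ipX : {dot X for rc_conj c}) (ipY : {dot Y for rc_conj c})
    (hX : hilbert ipX) (hY : hilbert ipY)
    (X_inf : infinite_dimensional X) (Y_inf : infinite_dimensional Y)
    (T : {linear X -> Y}) (T_inj : injective T) (T_bnd : bounded_operator c T)
    (T_range : ~ closed (range T))
    (TT_norm : opnorm c (normal_op ipX ipY T) <= expR (-1))
    (p rho : R) (p_gt0 : 0 < p) (rho_gt0 : 0 < rho) :
  (forall xdag : X, log_source_set ipX ipY T p rho xdag ->
   forall ydelta : R -> Y,
     (forall d, 0 < d -> rnorm c (ydelta d - T xdag) <= d) ->
     (fun d => rnorm c (xdag - reg_method ipX ipY T p d (ydelta d)))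
       =O_ (0^'+) f_log p)
  /\ order_optimal_log ipX ipY T p rho (reg_method ipX ipY T p).
Proof.
have [C C0 hC] := uniform_error_bound hX hY T_bnd TT_norm p_gt0 rho_gt0.
have small : \forall d \near (0 : R)^'+, 0 < d <= expR (- 2^-1).
  near=> d; apply/andP; split; first by near: d; exact: nbhs_right_gt.
  by near: d; apply: nbhs_right_le; exact: expR_gt0.
split=> [xdag src ydelta hyd|].
  apply/eqO_exP; exists (C + 1); first by rewrite ltr_wpDl.
  apply: filterS small => d dB; have [d0 _] := andP dB.
  rewrite !ger0_norm ?rnorm_ge0 ?f_log_ge0 // rnormB.
  apply: le_trans (hC d dB _ _ src (hyd d d0)) _.
  by rewrite ler_wpM2r ?f_log_ge0 // lerDl.
exists C; apply: filterS small => d dB.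
apply: ge_ereal_sup => _ [xdag [yd [src ydd ->]]].
by rewrite lee_fin; exact: hC.
Unshelve. all: by end_near. Qed.
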